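(* Let $N,n\ge 1$, let $c,\eta\in\mathbb C$ with $c\neq 0$, and consider canonical coordinates $p^a_i,q^a_i$ ($i=1,\dots,N$, $a=1,\dots,n$) with $\{p^a_i,q^b_j\}=\delta^{ab}\delta_{ij}$, $\{p^a_i,p^b_j\}=\{q^a_i,q^b_j\}=0$; the upper (site) indices are taken modulo $n$, so $q^0_i=q^n_i$, $p^0_i=p^n_i$, $q^{n+1}_i=q^1_i$, $p^{n+1}_i=p^1_i$. For $a=1,\dots,n$ define $N\times N$ matrices $$L^a_{ij}(z)=\phi(z,q^{a-1}_i-q^a_j+\eta)\,\frac{\prod_{l=1}^N\vartheta(q^a_j-q^{a-1}_l-\eta)}{\vartheta(-\eta)\prod_{l\neq j}\vartheta(q^a_j-q^a_l)}\,e^{p^a_j/c}.$$ Define $$r^a_{12}(z,w)=\sum_{i\neq j}\phi(z-w,q^a_i-q^a_j)E_{ij}\otimes E_{ji}+E_1(z-w)\sum_i E_{ii}\otimes E_{ii}-\sum_{i\neq j}E_1(q^a_i-q^a_j)E_{ii}\otimes E_{jj},$$ $$u^{+,a}_{12}=\sum_{i,j}E_1(q^{a-1}_j-q^a_i+\eta)E_{ii}\otimes E_{jj},\qquad u^{-,a}_{12}=-\sum_{i,j}E_1(q^{a-1}_i-q^a_j+\eta)E_{ii}\otimes E_{jj},$$ and with $D^a_{ij}(z)=L^a_{ij}(z)\big(E_1(z+q^{a-1}_i-q^a_j+\eta)-E_1(q^{a-1}_i-q^a_j+\eta)\big)$, $$s^a_{12}(z)=\sum_{i,j,m}(L^a(z)^{-1})_{mi}D^a_{ij}(z)E_{mj}\otimes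 E_{ii},\qquad s^a_{21}(w)=\sum_{i,j,m}(L^a(w)^{-1})_{mi}D^a_{ij}(w)E_{ii}\otimes E_{mj},$$ $s^{+,a}_{12}(z)=s^a_{12}(z)+u^{+,a}_{12}$, $s^{-,a}_{12}(w)=s^a_{21}(w)-u^{-,a}_{12}$. Then for all $a,b\in\{1,\dots,n\}$, identically in $z,w$, $$c\{L^a_1(z),L^b_2(w)\}=\delta^{ab}\Big(L^b_1(z)L^b_2(w)r^b_{12}(z,w)-r^{b-1}_{12}(z,w)L^b_1(z)L^b_2(w)+L^b_1(z)s^{+,b}_{12}(z)L^b_2(w)-L^b_2(w)s^{-,b}_{12}(w)L^b_1(z)\Big)$$ $$+\delta^{a,b-1}L^{b-1}_1(z)L^b_2(w)s^{-,b}_{12}(w)-\delta^{a,b+1}L^{b+1}_1(z)L^b_2(w)s^{+,b+1}_{12}(z),$$ where the Kronecker symbols $\delta^{a,b\pm1}$ and the indices $b\pm1$ are understood modulo $n$.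
   Context: $\vartheta(z)=-\sum_{j\in\mathbb Z}\exp\big(\pi\imath(j+\tfrac12)^2\tau+2\pi\imath(j+\tfrac12)(z+\tfrac12)\big)$ is the odd Jacobi theta function with $\mathrm{Im}\,\tau>0$; $\phi(z,u)=\frac{\vartheta'(0)\vartheta(z+u)}{\vartheta(z)\vartheta(u)}$; $E_1(u)=\vartheta'(u)/\vartheta(u)$. $E_{ij}$ are $N\times N$ matrix units; $L_1=L\otimes 1_N$, $L_2=1_N\otimes L$, $\{A_1(z),B_2(w)\}=\sum_{i,j,k,l}E_{ij}\otimes E_{kl}\{A_{ij}(z),B_{kl}(w)\}$. The Poisson bracket is $\{f,g\}=\sum_{a,i}(\partial_{p^a_i}f\,\partial_{q^a_i}g-\partial_{q^a_i}f\,\partial_{p^a_i}g)$. All quantities are taken at generic values so that they are defined (in particular $L^a(z)$ invertible). *)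

(* Defs.v *)
From mathcomp Require Import all_boot all_order all_algebra.
From mathcomp Require Import complex.
From mathcomp Require Import all_classical all_reals all_analysis.

Set Implicit Arguments.
Unset Strict Implicit.
Unset Printing Implicit Defensive.

Import Order.TTheory GRing.Theory Num.Theory numFieldNormedType.Exports.
Local Open Scope ring_scope.
Local Open Scope complex_scope.

Section Defs.
Variable R : realType.
Local Notation C := R[i].

Definition cexp (z : C) : C :=
  (expR (complex.Re z))%:C * ((cos (complex.Im z))%:C + 'i * (sin (complex.Im z))%:C).

Definition clim (u : nat -> C) : C :=
  Complex (limn (fun k => complex.Re (u k))) (limn (fun k => complex.Im (u k))).

(* derivative of f : C -> C at z, taken along the real direction; for a
   function holomorphic near z this is the complex derivative f'(z). *)
Definition cderiv (f : C -> C) (z : C) : C :=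
  Complex (derive1 (fun t : R => complex.Re (f (z + t%:C))) 0)
          (derive1 (fun t : R => complex.Im (f (z + t%:C))) 0).

Definition theta_term (tau z : C) (j : int) : C :=
  let h : C := j%:~R + 2^-1 in
  cexp ((pi%:C) * 'i * h ^+ 2 * tau + 2%:R * (pi%:C) * 'i * h * (z + 2^-1)).

(* vartheta(z) = - sum_{j in Z} theta_term j, the sum over Z being the limit
   of the symmetric partial sums over j = -M, ..., M-1 *)
Definition theta (tau z : C) : C :=
  - clim (fun M : nat => \sum_(k < (2 * M)%N) theta_term tau z (k%:Z - M%:Z)).

Definition theta' (tau z : C) : C := cderiv (theta tau) z.

Definition phi (tau z u : C) : C :=
  theta' tau 0 * theta tau (z + u) / (theta tau z * theta tau u).

Definition E1 (tau u : C) : C := theta' tau u / theta tau u.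

(* a point of phase space: (p, q), with p^a_i = X.1 a i, q^a_i = X.2 a i *)
Definition phase (N n : nat) := (('I_n -> 'I_N -> C) * ('I_n -> 'I_N -> C))%type.

Definition setc (N n : nat) (f : 'I_n -> 'I_N -> C) (a : 'I_n) (i : 'I_N) (x : C) :
  'I_n -> 'I_N -> C :=
  fun b j => if (b == a) && (j == i) then x else f b j.

Definition dp (N n : nat) (a : 'I_n) (i : 'I_N) (F : phase N n -> C) (X : phase N n) : C :=
  cderiv (fun x => F (setc X.1 a i x, X.2)) (X.1 a i).
Definition dq (N n : nat) (a : 'I_n) (i : 'I_N) (F : phase N n -> C) (X : phase N n) : C :=
  cderiv (fun x => F (X.1, setc X.2 a i x)) (X.2 a i).

Definition pbracket (N n : nat) (F G : phase N n -> C) (X : phase N n) : C :=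
  \sum_(a < n) \sum_(i < N) (dp a i F X * dq a i G X - dq a i F X * dp a i G X).

(* E_{ij} (x) E_{kl}, as an (N*N) x (N*N) matrix *)
Definition EE (N : nat) (i j k l : 'I_N) : 'M[C]_(N * N) :=
  delta_mx (mxvec_index i k) (mxvec_index j l).

Definition tens (N : nat) (A B : 'M[C]_N) : 'M[C]_(N * N) :=
  \sum_(i < N) \sum_(j < N) \sum_(k < N) \sum_(l < N) (A i j * B k l) *: EE i j k l.

Definition m1 (N : nat) (A : 'M[C]_N) : 'M[C]_(N * N) := tens A 1%:M.
Definition m2 (N : nat) (A : 'M[C]_N) : 'M[C]_(N * N) := tens 1%:M A.

Definition pbracket12 (N n : nat) (A B : phase N n -> 'M[C]_N) (X : phase N n) :
  'M[C]_(N * N) :=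
  \sum_(i < N) \sum_(j < N) \sum_(k < N) \sum_(l < N)
     pbracket (fun Y => A Y i j) (fun Y => B Y k l) X *: EE i j k l.

Variables (N n : nat) (tau eta c : C).

(* site indices modulo n: a-1 is ord_pred a, a+1 is ordS a *)
Definition Lmat (X : phase N n) (a : 'I_n) (z : C) : 'M[C]_N :=
  \matrix_(i < N, j < N)
    (phi tau z (X.2 (ord_pred a) i - X.2 a j + eta)
     * (\prod_(l < N) theta tau (X.2 a j - X.2 (ord_pred a) l - eta))
     / (theta tau (- eta) * \prod_(l < N | l != j) theta tau (X.2 a j - X.2 a l))
     * cexp (X.1 a j / c)).

Definition rmat (X : phase N n) (a : 'I_n) (z w : C) : 'M[C]_(N * N) :=
  \sum_(i < N) \sum_(j < N | i != j) phi tau (z - w) (X.2 a i - X.2 a j) *: EE i j j i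
  + E1 tau (z - w) *: \sum_(i < N) EE i i i i
  - \sum_(i < N) \sum_(j < N | i != j) E1 tau (X.2 a i - X.2 a j) *: EE i i j j.

Definition uplus (X : phase N n) (a : 'I_n) : 'M[C]_(N * N) :=
  \sum_(i < N) \sum_(j < N) E1 tau (X.2 (ord_pred a) j - X.2 a i + eta) *: EE i i j j.

Definition uminus (X : phase N n) (a : 'I_n) : 'M[C]_(N * N) :=
  - \sum_(i < N) \sum_(j < N) E1 tau (X.2 (ord_pred a) i - X.2 a j + eta) *: EE i i j j.

Definition Dent (X : phase N n) (a : 'I_n) (z : C) (i j : 'I_N) : C :=
  Lmat X a z i j
  * (E1 tau (z + X.2 (ord_pred a) i - X.2 a j + eta)
     - E1 tau (X.2 (ord_pred a) i - X.2 a j + eta)).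

Definition s12 (X : phase N n) (a : 'I_n) (z : C) : 'M[C]_(N * N) :=
  \sum_(i < N) \sum_(j < N) \sum_(m < N)
    (invmx (Lmat X a z) m i * Dent X a z i j) *: EE m j i i.

Definition s21 (X : phase N n) (a : 'I_n) (w : C) : 'M[C]_(N * N) :=
  \sum_(i < N) \sum_(j < N) \sum_(m < N)
    (invmx (Lmat X a w) m i * Dent X a w i j) *: EE i i m j.

Definition splus (X : phase N n) (a : 'I_n) (z : C) : 'M[C]_(N * N) :=
  s12 X a z + uplus X a.

Definition sminus (X : phase N n) (a : 'I_n) (w : C) : 'M[C]_(N * N) :=
  s21 X a w - uminus X a.

(* genericity: every theta value occurring in a denominator is nonzero and the
   Lax matrices at z and w are invertible *)
Definition generic (X : phase N n) (z w : C) : Prop :=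
  [/\ theta tau (- eta) != 0, theta tau z != 0, theta tau w != 0 &
      theta tau (z - w) != 0] /\
  (forall (a : 'I_n) (i j : 'I_N), i != j -> theta tau (X.2 a i - X.2 a j) != 0) /\
  (forall (a : 'I_n) (i j : 'I_N),
      [/\ theta tau (X.2 (ord_pred a) i - X.2 a j + eta) != 0,
          theta tau (z + X.2 (ord_pred a) i - X.2 a j + eta) != 0 &
          theta tau (w + X.2 (ord_pred a) i - X.2 a j + eta) != 0]) /\
  (forall a : 'I_n, Lmat X a z \in unitmx /\ Lmat X a w \in unitmx).

End Defs.

(* Main.v *)
(** Multiplying two theta series and splitting the double sum by parity gives
    theta(x+y) theta(x-y) = A(x) B(y) - B(x) A(y), whence the oddness of theta
    and, by the Plucker relation, Weierstrass' three-term identity.  Its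
    derivative on the diagonal expresses E1(a) + E1(b) - E1(c) - E1(d) for
    a + b = c + d as a quotient of theta values.  The (ij, kl) entry of
    c {L^a_1, L^b_2} is L^a_ij L^b_kl times a difference of logarithmic
    q-derivatives.  Those in the variables of the previous site are exactly the
    entries of L s^+ and L s^-, because the factor L^(-1) in s cancels.  Those in
    the variables of the own site reduce, according to whether i = k and j = l, to
    the product formula [phi_product] or to the exchange relation
    [phi_exchange] for phi. *)

Require Import Defs.
From mathcomp Require Import all_boot all_order all_algebra complex.
From mathcomp Require Import all_classical all_reals all_analysis.
From mathcomp Require Import ring lra zify.
Import Order.TTheory GRing.Theory Num.Theory numFieldNormedType.Exports.
Local Open Scope ring_scope.

Set Implicit Arguments.
Unset Strict Implicit.
Unset Printing Implicit Defensive.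

(** No quasi-periodicity and no Liouville argument enters: every theta identity comes from
    rearranging series. A limit of symmetric partial sums does not by itself permit rearrangement,
    so [theta] is first identified with an unconditional sum ([hsum]), for which reindexing,
    disjoint unions of index sets and products are available. Derivatives are only taken along the
    real direction. A real shift of the argument multiplies each summand of theta by a phase of
    modulus one, which yields a global quadratic remainder estimate; this replaces both holomorphy
    and termwise differentiation. Logarithmic derivatives are encoded without a logarithm, as
    relations f'(0) = f(0) l. For [n = 1] a site is its own predecessor, and for [n = 2] both
    neighbours coincide, so several Kronecker symbols may be 1 at once. The derivative formulas are
    therefore sums weighted by these symbols, never a case distinction on the sites. *)

(** * Real and imaginary parts, and a real-valued norm *)

Section ComplexParts.
Variable R : realType.
Local Notation C := R[i].
Implicit Types x y z : C.

Lemma cReD x y : complex.Re (x + y) = complex.Re x + complex.Re y.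
Proof. by case: x y => [a b] [c d]. Qed.

Lemma cImD x y : complex.Im (x + y) = complex.Im x + complex.Im y.
Proof. by case: x y => [a b] [c d]. Qed.

Lemma cReN x : complex.Re (- x) = - complex.Re x.
Proof. by case: x. Qed.

Lemma cImN x : complex.Im (- x) = - complex.Im x.
Proof. by case: x. Qed.

Lemma cReM x y : complex.Re (x * y)
  = complex.Re x * complex.Re y - complex.Im x * complex.Im y.
Proof. by case: x y => [a b] [c d]. Qed.

Lemma cImM x y : complex.Im (x * y)
  = complex.Re x * complex.Im y + complex.Im x * complex.Re y.
Proof. by case: x y => [a b] [c d]. Qed.

Lemma complexP x y :
  complex.Re x = complex.Re y -> complex.Im x = complex.Im y -> x = y.
Proof. by case: x y => [a b] [c d] /= -> ->. Qed.

Lemma cRe_sum (I : Type) (s : seq I) (f : I -> C) :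
  complex.Re (\sum_(i <- s) f i) = \sum_(i <- s) complex.Re (f i).
Proof. exact: (big_morph _ cReD). Qed.

Lemma cIm_sum (I : Type) (s : seq I) (f : I -> C) :
  complex.Im (\sum_(i <- s) f i) = \sum_(i <- s) complex.Im (f i).
Proof. exact: (big_morph _ cImD). Qed.

(* The l^1 norm: real valued, submultiplicative, and easier to bound than the modulus. *)
Definition nrm x : R := `|complex.Re x| + `|complex.Im x|.

Lemma nrm_ge0 x : 0 <= nrm x.
Proof. by rewrite addr_ge0. Qed.

Lemma nrm0 : nrm 0 = 0.
Proof. by rewrite /nrm /= normr0 addr0. Qed.

Lemma nrm0_eq0 x : nrm x = 0 -> x = 0.
Proof.
case: x => a b /eqP; rewrite /nrm /= paddr_eq0 // !normr_eq0.
by move=> /andP[/eqP -> /eqP ->].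
Qed.

Lemma nrmN x : nrm (- x) = nrm x.
Proof. by case: x => a b; rewrite /nrm /= !normrN. Qed.

Lemma ler_nrmD x y : nrm (x + y) <= nrm x + nrm y.
Proof.
rewrite /nrm cReD cImD.
have := ler_normD (complex.Re x) (complex.Re y).
have := ler_normD (complex.Im x) (complex.Im y).
lra.
Qed.

Lemma ler_nrmM x y : nrm (x * y) <= nrm x * nrm y.
Proof.
rewrite /nrm cReM cImM.
have := ler_normB (complex.Re x * complex.Re y) (complex.Im x * complex.Im y).
have := ler_normD (complex.Re x * complex.Im y) (complex.Im x * complex.Re y).
rewrite !normrM; lra.
Qed.

Lemma ler_nrm_sum (I : Type) (s : seq I) (f : I -> C) :
  nrm (\sum_(i <- s) f i) <= \sum_(i <- s) nrm (f i).
Proof.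
elim: s => [|i s IH]; first by rewrite !big_nil nrm0.
by rewrite !big_cons (le_trans (ler_nrmD _ _)) // lerD2l.
Qed.

Lemma nrm_real (r : R) : nrm (Complex r 0) = `|r|.
Proof. by rewrite /nrm /= normr0 addr0. Qed.

Lemma ler_Re_nrm x : `|complex.Re x| <= nrm x.
Proof. by rewrite lerDl. Qed.

Lemma ler_Im_nrm x : `|complex.Im x| <= nrm x.
Proof. by rewrite lerDr. Qed.

End ComplexParts.

(** * Unconditional summation over arbitrary index types *)

Section UnconditionalSums.
Variable R : realType.
Local Notation C := R[i].

Lemma big_uniq_sub (V : nmodType) (T : eqType) (s0 s : seq T) (f : T -> V) :
  uniq s0 -> uniq s -> {subset s0 <= s} ->
  \sum_(x <- s) f x
  = \sum_(x <- s0) f x + \sum_(x <- [seq x <- s | x \notin s0]) f x.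
Proof.
move=> u0 us sub; rewrite -big_cat; apply: perm_big; apply: uniq_perm => //.
  rewrite cat_uniq u0 filter_uniq // andbT /=.
  by apply/hasPn => x; rewrite mem_filter => /andP[].
move=> x; rewrite mem_cat mem_filter.
by case: (boolP (x \in s0)) => //= /sub ->.
Qed.

(* Absolutely convergent summation along the net of finite subsets. *)
Definition hsum (T : eqType) (f : T -> C) (S : C) : Prop :=
  forall e : R, 0 < e -> exists2 s0 : seq T, uniq s0 &
    nrm (S - \sum_(x <- s0) f x) <= e /\
    forall s, uniq s -> all (fun x => x \notin s0) s ->
      \sum_(x <- s) nrm (f x) <= e.

(** The definition gives one witness set; this version holds for all its finite supersets, so that
    the witnesses of two families can be replaced by their union. The terms added to the witness
    cost the second [e / 2]. *)
Lemma hsum_tail (T : eqType) (f : T -> C) (S : C) : hsum f S ->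
  forall e : R, 0 < e -> exists2 s0 : seq T, uniq s0 &
    forall s, uniq s -> {subset s0 <= s} ->
    nrm (S - \sum_(x <- s) f x) <= e /\
    forall t, uniq t -> all (fun x => x \notin s) t ->
      \sum_(x <- t) nrm (f x) <= e.
Proof.
move=> H e e0; have [|s0 u0 [H1 H2]] := H (e / 2); first by rewrite divr_gt0.
exists s0 => // s us sub; split; last first.
  move=> t ut /allP dt; apply: le_trans (H2 t ut _) _; last by lra.
  by apply/allP => x /dt; apply: contra => /sub.
rewrite (big_uniq_sub f u0 us sub) opprD addrA.
apply: le_trans (ler_nrmD _ _) _; rewrite nrmN.
have := ler_nrm_sum [seq x <- s | x \notin s0] f.
have := H2 [seq x <- s | x \notin s0] (filter_uniq _ us) (filter_all _ _).
by lra.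
Qed.

Lemma nrm_small_eq0 (x : C) : (forall e : R, 0 < e -> nrm x <= e) -> x = 0.
Proof.
move=> H; apply: nrm0_eq0; apply/eqP; rewrite eq_le nrm_ge0 andbT.
by apply/ler_addgt0Pr => e e0; rewrite add0r H.
Qed.

Lemma hsum_unique (T : eqType) (f : T -> C) S S' :
  hsum f S -> hsum f S' -> S = S'.
Proof.
move=> /hsum_tail H /hsum_tail H'; apply/eqP; rewrite -subr_eq0; apply/eqP.
apply: nrm_small_eq0 => e e0.
have e2 : 0 < e / 2 by rewrite divr_gt0.
have [s us Hs] := H _ e2; have [t ut Ht] := H' _ e2.
have [|h _] := Hs _ (undup_uniq (s ++ t)).
  by move=> x xs; rewrite mem_undup mem_cat xs.
have [|h' _] := Ht _ (undup_uniq (s ++ t)).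
  by move=> x xs; rewrite mem_undup mem_cat xs orbT.
move: h h'; set X := \sum_(_ <- _) _ => h h'.
have -> : S - S' = (S - X) - (S' - X) by ring.
apply: le_trans (ler_nrmD _ _) _; rewrite nrmN; lra.
Qed.

Lemma eq_hsum (T : eqType) (f g : T -> C) S : f =1 g -> hsum f S -> hsum g S.
Proof. by move=> /funext ->. Qed.

Lemma hsumD (T : eqType) (f g : T -> C) S S' :
  hsum f S -> hsum g S' -> hsum (fun x => f x + g x) (S + S').
Proof.
move=> /hsum_tail H /hsum_tail H' e e0.
have e2 : 0 < e / 2 by rewrite divr_gt0.
have [s us Hs] := H _ e2; have [t ut Ht] := H' _ e2.
exists (undup (s ++ t)); first exact: undup_uniq.
have [|h1 h2] := Hs _ (undup_uniq (s ++ t)).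
  by move=> x xs; rewrite mem_undup mem_cat xs.
have [|h1' h2'] := Ht _ (undup_uniq (s ++ t)).
  by move=> x xs; rewrite mem_undup mem_cat xs orbT.
split.
  rewrite big_split /= opprD addrACA; apply: le_trans (ler_nrmD _ _) _; lra.
move=> r ur dr; have := h2 r ur dr; have := h2' r ur dr.
suff : \sum_(x <- r) nrm (f x + g x)
  <= \sum_(x <- r) nrm (f x) + \sum_(x <- r) nrm (g x) by lra.
by rewrite -big_split ler_sum //= => x _; apply: ler_nrmD.
Qed.

Lemma hsumZ (T : eqType) (f : T -> C) a S :
  hsum f S -> hsum (fun x => a * f x) (a * S).
Proof.
(* The summand 1 keeps the divisor positive when [a = 0]. *)
move=> H e e0; have ka : 0 < nrm a + 1 by have := nrm_ge0 a; lra.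
have [|s us [h1 h2]] := H (e / (nrm a + 1)); first by rewrite divr_gt0.
have scale y : y <= e / (nrm a + 1) -> 0 <= y -> nrm a * y <= e.
  rewrite ler_pdivlMr // => h y0; apply: le_trans h.
  by rewrite mulrC ler_wpM2l // lerDl.
exists s => //; split.
  rewrite -mulr_sumr -mulrBr; apply: le_trans (ler_nrmM _ _) _.
  by apply: scale h1 _; apply: nrm_ge0.
move=> r ur dr; apply: le_trans (scale _ (h2 r ur dr) _).
  by rewrite mulr_sumr ler_sum // => x _; apply: ler_nrmM.
by apply: sumr_ge0 => x _; apply: nrm_ge0.
Qed.

Lemma hsumN (T : eqType) (f : T -> C) S :
  hsum f S -> hsum (fun x => - f x) (- S).
Proof.
move=> /(hsumZ (-1)); rewrite mulN1r; apply: eq_hsum => x.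
by rewrite mulN1r.
Qed.

Lemma hsum_reindex (T U : eqType) (h : U -> T) (h' : T -> U) (f : T -> C) S :
  cancel h h' -> cancel h' h -> hsum f S -> hsum (f \o h) S.
Proof.
move=> hK h'K H e e0; have [s us [h1 h2]] := H e e0.
exists (map h' s); first by rewrite map_inj_uniq //; apply: can_inj h'K.
split.
  by rewrite big_map; under eq_bigr do rewrite /= h'K.
move=> r ur /allP dr; rewrite -(big_map h xpredT (fun y => nrm (f y))).
apply: h2; first by rewrite map_inj_uniq //; apply: can_inj hK.
apply/allP => _ /mapP[x /dr xr ->]; apply: contra xr => xs.
by apply/mapP; exists (h x).
Qed.

Definition sum_inl (T U : eqType) (s : seq (T + U)) : seq T :=
  pmap (fun x => if x is inl y then Some y else None) s.
Definition sum_inr (T U : eqType) (s : seq (T + U)) : seq U :=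
  pmap (fun x => if x is inr y then Some y else None) s.

Lemma big_sum_type (V : nmodType) (T U : eqType) (f : T + U -> V)
    (s : seq (T + U)) :
  \sum_(x <- s) f x
  = \sum_(x <- sum_inl s) f (inl x) + \sum_(x <- sum_inr s) f (inr x).
Proof.
elim: s => [|[x|x] s IH]; first by rewrite !big_nil addr0.
  by rewrite /= !big_cons IH addrA.
by rewrite /= !big_cons IH addrCA.
Qed.

Lemma mem_sum_inl (T U : eqType) (s : seq (T + U)) x :
  (x \in sum_inl s) = (inl x \in s).
Proof.
by elim: s => [|[y|y] s IH] //=; rewrite ?in_cons ?IH.
Qed.

Lemma mem_sum_inr (T U : eqType) (s : seq (T + U)) x :
  (x \in sum_inr s) = (inr x \in s).
Proof.
by elim: s => [|[y|y] s IH] //=; rewrite ?in_cons ?IH.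
Qed.

Lemma uniq_sum_inl (T U : eqType) (s : seq (T + U)) : uniq s -> uniq (sum_inl s).
Proof.
elim: s => [|[y|y] s IH] //= /andP[ys /IH] //; by rewrite mem_sum_inl ys.
Qed.

Lemma uniq_sum_inr (T U : eqType) (s : seq (T + U)) : uniq s -> uniq (sum_inr s).
Proof.
elim: s => [|[y|y] s IH] //= /andP[ys /IH] //; by rewrite mem_sum_inr ys.
Qed.

(** This is what allows a double series to be cut into two subfamilies by parity. *)
Lemma hsum_sum_type (T U : eqType) (f : T + U -> C) S S' :
  hsum (f \o inl) S -> hsum (f \o inr) S' -> hsum f (S + S').
Proof.
move=> H H' e e0; have e2 : 0 < e / 2 by rewrite divr_gt0.
have [s us [h1 h2]] := H _ e2; have [t ut [h1' h2']] := H' _ e2.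
have El : sum_inl (map inl s ++ map inr t) = s.
  rewrite /sum_inl pmap_cat; set a := pmap _ _; set b := pmap _ _.
  have -> : a = s by rewrite /a; elim: (s) => //= x r ->.
  have -> : b = [::] by rewrite /b; elim: (t) => //= x r ->.
  by rewrite cats0.
have Er : sum_inr (map inl s ++ map inr t) = t.
  rewrite /sum_inr pmap_cat; set a := pmap _ _; set b := pmap _ _.
  have -> : a = [::] by rewrite /a; elim: (s) => //= x r ->.
  by rewrite /b; elim: (t) => //= x r ->.
exists (map inl s ++ map inr t).
  rewrite cat_uniq !map_inj_uniq ?us ?ut /=; try by move=> ? ? [].
  by rewrite andbT; apply/hasPn => _ /mapP[x _ ->]; apply/mapP => -[].
split.
  rewrite big_sum_type El Er opprD addrACA.
  by apply: le_trans (ler_nrmD _ _) _; move: h1 h1'; rewrite /=; lra.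
move=> r ur /allP dr; rewrite big_sum_type.
have := h2 _ (uniq_sum_inl ur) _; have := h2' _ (uniq_sum_inr ur) _ => /=.
move=> A B; have : \sum_(x <- sum_inl r) nrm (f (inl x)) <= e / 2.
  apply: B; apply/allP => x; rewrite mem_sum_inl => /dr.
  by rewrite -mem_sum_inl El.
have : \sum_(x <- sum_inr r) nrm (f (inr x)) <= e / 2.
  apply: A; apply/allP => x; rewrite mem_sum_inr => /dr.
  by rewrite -mem_sum_inr Er.
lra.
Qed.

Lemma ler_sum_uniq_sub (T : eqType) (s t : seq T) (f : T -> R) :
  (forall x, 0 <= f x) -> uniq s -> uniq t -> {subset s <= t} ->
  \sum_(x <- s) f x <= \sum_(x <- t) f x.
Proof.
move=> f0 us ut sub; rewrite (big_uniq_sub f us ut sub) lerDl.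
exact: sumr_ge0.
Qed.

(** Any finite set lies in the union of the witness set for error 1 and a set disjoint from it,
    which contributes at most 1. *)
Lemma hsum_bounded (T : eqType) (f : T -> C) S : hsum f S ->
  exists2 M : R, 0 < M & forall s, uniq s -> \sum_(x <- s) nrm (f x) <= M.
Proof.
move=> /(_ 1 ltr01)[s us [_ h]].
have n0 x : 0 <= nrm (f x) by apply: nrm_ge0.
exists (\sum_(x <- s) nrm (f x) + 1).
  by have : 0 <= \sum_(x <- s) nrm (f x) by [apply: sumr_ge0]; lra.
move=> t ut.
apply: le_trans (ler_sum_uniq_sub n0 ut (undup_uniq (s ++ t)) _) _.
  by move=> x xt; rewrite mem_undup mem_cat xt orbT.
rewrite (big_uniq_sub _ us (undup_uniq (s ++ t))).
  by rewrite lerD2l h ?filter_uniq ?undup_uniq ?filter_all.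
by move=> x xt; rewrite mem_undup mem_cat xt.
Qed.

Lemma big_box (V : pzRingType) (T U : Type) (s : seq T) (t : seq U)
    (f : T -> V) (g : U -> V) :
  \sum_(x <- [seq (a, b) | a <- s, b <- t]) (f x.1 * g x.2)
  = (\sum_(x <- s) f x) * (\sum_(x <- t) g x).
Proof. by rewrite big_allpairs mulr_suml; under [RHS]eq_bigr do rewrite mulr_sumr. Qed.

Lemma uniq_box (T U : eqType) (s : seq T) (t : seq U) :
  uniq s -> uniq t -> uniq [seq (a, b) | a <- s, b <- t].
Proof. by move=> us ut; apply: allpairs_uniq => // -[a b] [a' b'] _ _ /=. Qed.

(** The witness is the box [s] times [t]. A finite set off this box lies in a larger box minus the
    smaller one, and with the sums a, b over the sides and a', b' over their extensions the excess
    is (a + a')(b + b') - ab = a b' + a'(b + b'). *)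
Lemma hsumM (T U : eqType) (f : T -> C) (g : U -> C) S S' :
  hsum f S -> hsum g S' ->
  hsum (fun x : T * U => f x.1 * g x.2) (S * S').
Proof.
move=> H H' e e0.
have [M M0 HM] := hsum_bounded H; have [M' M0' HM'] := hsum_bounded H'.
(* [K] dominates [nrm S + M'] and [M + M'], the total factors of [e / K] in the head and the tail
   estimate. *)
pose K := M + M' + nrm S + 1.
have K0 : 0 < K by rewrite /K; have := nrm_ge0 S; lra.
have d0 : 0 < e / K by rewrite divr_gt0.
have [s us [h1 h2]] := H _ d0; have [t ut [h1' h2']] := H' _ d0.
have dK : e / K * K = e by rewrite divfK // gt_eqF.
exists [seq (a, b) | a <- s, b <- t]; first exact: uniq_box.
set X := \sum_(x <- s) f x in h1; set Y := \sum_(x <- t) g x in h1'.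
have nf x : 0 <= nrm (f x) by apply: nrm_ge0.
have ng x : 0 <= nrm (g x) by apply: nrm_ge0.
split.
  rewrite big_box -/X -/Y.
  have -> : S * S' - X * Y = S * (S' - Y) + (S - X) * Y by ring.
  apply: le_trans (ler_nrmD _ _) _.
  have := ler_nrmM S (S' - Y); have := ler_nrmM (S - X) Y.
  have A : nrm S * nrm (S' - Y) <= nrm S * (e / K).
    by rewrite ler_wpM2l ?nrm_ge0.
  have B : nrm (S - X) * nrm Y <= e / K * M'.
    apply: ler_pM => //; try exact: nrm_ge0.
    exact: le_trans (ler_nrm_sum _ _) (HM' t ut).
  have D : 0 <= e / K * M by rewrite mulr_ge0 // ltW.
  move: dK; rewrite /K; move: (e / _) d0 A B D => d d0 A B D; lra.
move=> r ur /allP dr.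
(* The sides of a box that contains both the witness box and [r]. *)
pose s1 := undup (s ++ map fst r); pose t1 := undup (t ++ map snd r).
have us1 : uniq s1 by apply: undup_uniq.
have ut1 : uniq t1 by apply: undup_uniq.
have ss1 : {subset s <= s1} by move=> x xs; rewrite mem_undup mem_cat xs.
have tt1 : {subset t <= t1} by move=> x xs; rewrite mem_undup mem_cat xs.
pose F (x : T * U) := nrm (f x.1) * nrm (g x.2).
have F0 x : 0 <= F x by rewrite mulr_ge0.
apply: (@le_trans _ _ (\sum_(x <- r) F x)).
  by apply: ler_sum => x _; apply: ler_nrmM.
have Hb : \sum_(x <- [seq (a, b) | a <- s, b <- t]) F x + \sum_(x <- r) F x
   <= \sum_(x <- [seq (a, b) | a <- s1, b <- t1]) F x.
  rewrite -big_cat; apply: ler_sum_uniq_sub => //.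
  - rewrite cat_uniq uniq_box // ur andbT /=.
    by apply/hasPn => x /dr.
  - exact: uniq_box.
  move=> x; rewrite mem_cat => /orP[/allpairsP[[a b] /= [ha hb ->]]|xr].
    by apply: allpairs_f; [apply: ss1|apply: tt1].
  rewrite (surjective_pairing x); apply: allpairs_f.
    by rewrite mem_undup mem_cat map_f ?orbT.
  by rewrite mem_undup mem_cat map_f ?orbT.
have boxE u v : \sum_(x <- [seq (a, b) | a <- u, b <- v]) F x
    = (\sum_(x <- u) nrm (f x)) * (\sum_(x <- v) nrm (g x)).
  exact: (big_box u v (fun x => nrm (f x)) (fun x => nrm (g x))).
move: Hb; rewrite !boxE (big_uniq_sub _ us us1 ss1) (big_uniq_sub _ ut ut1 tt1).
set a := \sum_(x <- s) _; set b := \sum_(x <- t) _.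
set a' := \sum_(x <- _) nrm (f _); set b' := \sum_(x <- [seq x <- t1 | _]) _.
have ha : a' <= e / K by apply: h2; rewrite ?filter_uniq ?filter_all.
have hb : b' <= e / K by apply: h2'; rewrite ?filter_uniq ?filter_all.
have a0 : 0 <= a by apply: sumr_ge0.
have b0 : 0 <= b by apply: sumr_ge0.
have a0' : 0 <= a' by apply: sumr_ge0.
have b0' : 0 <= b' by apply: sumr_ge0.
have hM : a <= M by apply: HM.
have hM' : b + b' <= M'.
  by rewrite -(big_uniq_sub _ ut ut1 tt1); apply: HM'.
have A : a * b' <= M * (e / K) by apply: ler_pM.
have B : a' * (b + b') <= e / K * M' by apply: ler_pM => //; lra.
have D : 0 <= e / K * nrm S by rewrite mulr_ge0 ?nrm_ge0 // ltW.
move: dK; rewrite {2}/K; move: (e / _) d0 A B D => d d0 A B D; lra.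
Qed.

(** The sum is the supremum of the finite partial sums. A set whose partial sum comes within [e] of
    it is a witness, since a disjoint set can add at most what is missing. *)
Lemma hsum_ex_nonneg (T : eqType) (f : T -> R) (M : R) :
  (forall x, 0 <= f x) ->
  (forall s, uniq s -> \sum_(x <- s) f x <= M) ->
  exists S, hsum (fun x => Complex (f x) 0) S.
Proof.
move=> f0 fM.
pose E := [set y | exists2 s, uniq s & y = \sum_(x <- s) f x]%classic.
have hE : has_sup E.
  split; first by exists 0; exists [::]; rewrite ?big_nil.
  by exists M => _ [s us ->]; apply: fM.
exists (Complex (sup E) 0) => e e0.
have [_ [s us ->] hs] := sup_adherent e0 hE.
exists s => //; split.
  have -> : Complex (sup E) 0 - \sum_(x <- s) Complex (f x) 0
    = Complex (sup E - \sum_(x <- s) f x) 0.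
    apply: complexP; rewrite ?cReD ?cImD ?cReN ?cImN ?cRe_sum ?cIm_sum //=.
    by rewrite big1 // subr0.
  have := sup_upper_bound hE (ex_intro2 _ _ s us erefl).
  by rewrite nrm_real ler_norml => h; apply/andP; split; lra.
move=> t ut dt; under eq_bigr do rewrite nrm_real ger0_norm //.
have : \sum_(x <- s ++ t) f x <= sup E.
  apply: sup_upper_bound => //; exists (s ++ t) => //.
  by rewrite cat_uniq us ut andbT /= -all_predC.
rewrite big_cat /=; lra.
Qed.

(** Reduction to nonnegative families: a real [g] dominated by [nrm f] is the difference of
    [nrm f + g] and [nrm f], and [f] is its real part plus i times its imaginary part. *)
Lemma hsum_ex (T : eqType) (f : T -> C) (M : R) :
  (forall s, uniq s -> \sum_(x <- s) nrm (f x) <= M) -> exists S, hsum f S.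
Proof.
move=> fM.
have part (g : T -> R) : (forall x, `|g x| <= nrm (f x)) ->
    exists S, hsum (fun x => Complex (g x) 0) S.
  move=> gf.
  have [|s us|S1 H1] := @hsum_ex_nonneg T (fun x => nrm (f x) + g x) (M + M).
  - by move=> x; have := gf x; rewrite ler_norml => /andP[]; lra.
  - have := fM s us; suff : \sum_(x <- s) (nrm (f x) + g x)
        <= \sum_(x <- s) nrm (f x) + \sum_(x <- s) nrm (f x) by lra.
    rewrite -big_split ler_sum //= => x _.
    by have := gf x; rewrite ler_norml => /andP[]; lra.
  have [|S2 H2] := @hsum_ex_nonneg T (fun x => nrm (f x)) M _ fM.
    by move=> x; apply: nrm_ge0.
  exists (S1 + - S2); apply: eq_hsum (hsumD H1 (hsumN H2)) => x.
  by apply: complexP; rewrite ?cReD ?cImD ?cReN ?cImN /=; ring.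
have [S1 H1] := part _ (fun x => ler_Re_nrm (f x)).
have [S2 H2] := part _ (fun x => ler_Im_nrm (f x)).
exists (S1 + Complex 0 1 * S2); apply: eq_hsum (hsumD H1 (hsumZ (Complex 0 1) H2)) => x.
by apply: complexP; rewrite ?cReD ?cImD ?cReM ?cImM /=; ring.
Qed.

Lemma geometric_bound (r : R) (s : seq nat) : 0 <= r < 1 -> uniq s ->
  \sum_(k <- s) r ^+ k <= (1 - r)^-1.
Proof.
move=> /andP[r0 r1] us; pose m := (\max_(k <- s) k).+1.
apply: (@le_trans _ _ (\sum_(k <- iota 0 m) r ^+ k)).
  apply: ler_sum_uniq_sub => //; first by move=> x; apply: exprn_ge0.
    exact: iota_uniq.
  by move=> x xs; rewrite mem_iota /= ltnS; apply: leq_bigmax_seq.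
rewrite -[iota 0 m]/(index_iota 0 m) big_mkord.
have := subrX1 r m; set s1 := \sum_(i < m) _ => h.
have d : 0 < 1 - r by lra.
rewrite -[leRHS]mul1r ler_pdivlMr //.
by have := exprn_ge0 m r0; lra.
Qed.

Lemma hsum_int_geometric (f : int -> C) (K r : R) : 0 <= r < 1 -> 0 <= K ->
  (forall j, nrm (f j) <= K * r ^+ absz j) -> exists S, hsum f S.
Proof.
move=> r01 K0 fb.
have r0 : 0 <= r by case/andP: r01.
have half (g : nat -> C) : (forall k, nrm (g k) <= K * r ^+ k) ->
    exists S, hsum g S.
  move=> gb; apply: (@hsum_ex _ _ (K * (1 - r)^-1)) => s us.
  apply: (@le_trans _ _ (\sum_(x <- s) K * r ^+ x)).
    by apply: ler_sum => x _.
  by rewrite -mulr_sumr ler_wpM2l // geometric_bound.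
have [|S1 H1] := half (fun k => f (Posz k)); first by move=> k; apply: fb.
(* Since [absz (Negz k)] is [k.+1], the bound carries one spare factor [r], which is at most 1. *)
have [|S2 H2] := half (fun k => f (Negz k)).
  move=> k; apply: le_trans (fb _) _; rewrite ler_wpM2l //=.
  by rewrite exprS ler_piMl ?exprn_ge0 //; case/andP: r01 => _ /ltW.
pose h (x : nat + nat) : int := match x with inl k => Posz k | inr k => Negz k end.
pose h' (j : int) : nat + nat := match j with Posz k => inl k | Negz k => inr k end.
exists (S1 + S2).
have H : hsum (f \o h) (S1 + S2) by apply: hsum_sum_type.
have hK : cancel h h' by case.
have h'K : cancel h' h by case.
by apply: eq_hsum (hsum_reindex h'K hK H) => j /=; rewrite h'K.
Qed.

End UnconditionalSums.

(** * Theta as an unconditional sum, its oddness and the three-term identity *)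

Section ThetaAddition.
Variable R : realType.
Local Notation C := R[i].
Local Open Scope complex_scope.
Implicit Types x y z : C.

Lemma cexpD x y : cexp (x + y) = cexp x * cexp y.
Proof.
apply: complexP; rewrite /cexp ?cReD ?cImD ?cReM ?cImM /= ?cReD ?cImD ?cReM ?cImM /=;
  rewrite expRD cosD sinD; ring.
Qed.

Lemma cexp0 : cexp (0 : C) = 1.
Proof.
by apply: complexP; rewrite /cexp ?cReM ?cImM /= ?cReM ?cImM /= expR0 cos0 sin0; ring.
Qed.

Lemma nrm_cexp z : nrm (cexp z) <= 2 * expR (complex.Re z).
Proof.
have -> : cexp z = Complex (expR (complex.Re z)) 0
    * Complex (cos (complex.Im z)) (sin (complex.Im z)).
  by apply: complexP; rewrite /cexp ?cReD ?cImD ?cReM ?cImM /= ?cReD ?cImD ?cReM ?cImM /=; ring.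
apply: le_trans (ler_nrmM _ _) _; rewrite nrm_real gtr0_norm ?expR_gt0 // mulrC.
rewrite ler_wpM2r ?expR_ge0 // /nrm /=.
by have := cos_max (complex.Im z); have := sin_max (complex.Im z); lra.
Qed.

Lemma cexpE (a b : R) : cexp (Complex a b) = Complex (expR a * cos b) (expR a * sin b).
Proof.
by apply: complexP; rewrite /cexp ?cReM ?cImM /= ?cReD ?cImD ?cReM ?cImM /=; ring.
Qed.

Lemma cexp_pi : cexp (pi%:C * 'i : C) = -1.
Proof.
have -> : pi%:C * 'i = Complex 0 pi :> C by apply: complexP; rewrite ?cReM ?cImM /=; ring.
by rewrite cexpE expR0 cospi sinpi; apply: complexP => /=; ring.
Qed.

Lemma cexp_2pi_int (s : int) : cexp (2 * pi%:C * 'i * s%:~R : C) = 1.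
Proof.
have e1 : cexp (2 * pi%:C * 'i : C) = 1.
  have -> : 2 * pi%:C * 'i = pi%:C * 'i + pi%:C * 'i :> C by ring.
  by rewrite cexpD cexp_pi mulrNN mulr1.
have en (k : nat) : cexp (2 * pi%:C * 'i * k%:R : C) = 1.
  elim: k => [|k IH]; first by rewrite mulr0 cexp0.
  by rewrite -(natr1 k) mulrDr mulr1 cexpD IH e1 mulr1.
case: s => k; first exact: en.
rewrite NegzE mulrNz.
have := cexpD (2 * pi%:C * 'i * k.+1%:R) (2 * pi%:C * 'i * - k.+1%:R).
by rewrite -mulrDr subrr mulr0 cexp0 en mul1r => <-.
Qed.

Lemma cexp_period x (s : int) : cexp (x + 2 * pi%:C * 'i * s%:~R) = cexp x.
Proof. by rewrite cexpD cexp_2pi_int mulr1. Qed.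

Lemma cexp_antiperiod x : cexp (x + pi%:C * 'i) = - cexp x.
Proof. by rewrite cexpD cexp_pi mulrN1. Qed.

(** The Gaussian summand of frequency [h]. Theta uses half-integers [h] with modulus [tau]; the
    parity split of a product uses even and odd integers with modulus [tau / 2]. *)
Definition gterm (tau x h : C) : C :=
  cexp (pi%:C * 'i * tau * h ^+ 2 + 2 * pi%:C * 'i * x * h).

(** The weight 1 + h^2 is there for the series with an extra factor h or h^2 that arise on
    differentiating theta. It is at most exp(2|h|), and completing the square absorbs all linear
    terms. *)
Lemma gaussian_bound (a b : R) : 0 < a -> exists2 K : R, 0 < K &
  forall h : R, expR (- a * h ^+ 2 - b * h) * (1 + h ^+ 2) <= K * expR (- `|h|).
Proof.
(* In 3 = 2 + 1, the 2 pays for the weight and the 1 for the decay exp(-|h|) kept on the right; c^2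
   / (4a) is the maximum of c|h| - a|h|^2. *)
move=> a0; pose c : R := `|b| + 3; exists (expR (c ^+ 2 / (4 * a))); first exact: expR_gt0.
move=> h; have h2 : h ^+ 2 = `|h| ^+ 2 by rewrite real_normK ?num_real.
have u0 : 0 <= `|h| by [].
have poly : 1 + h ^+ 2 <= expR (2 * `|h|).
  have -> : 2 * `|h| = `|h| + `|h| by ring.
  rewrite expRD; have := expR_ge1Dx `|h| => e1.
  have := ler_pM (_ : 0 <= 1 + `|h|) (_ : 0 <= 1 + `|h|) e1 e1.
  move=> /(_ _ _); rewrite h2; have : 0 <= 1 + `|h| by lra.
  by move=> p /(_ p p); nra.
apply: le_trans (ler_wpM2l _ poly) _; first exact: expR_ge0.
rewrite -!expRD ler_expR h2.
have hb : - b * h <= `|b| * `|h| by rewrite -normrM mulNr -normrN ler_norm.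
have sq : 0 <= (2 * a * `|h| - c) ^+ 2 / (4 * a).
  by rewrite divr_ge0 ?sqr_ge0 // mulr_ge0 // ltW.
have E : (2 * a * `|h| - c) ^+ 2 / (4 * a)
    = a * `|h| ^+ 2 - c * `|h| + c ^+ 2 / (4 * a).
  by field; rewrite gt_eqF.
move: sq; rewrite E /c; lra.
Qed.

Lemma Re_gexponent (tau x : C) (h : R) :
  complex.Re (pi%:C * 'i * tau * h%:C ^+ 2 + 2 * pi%:C * 'i * x * h%:C)
  = - (pi * complex.Im tau) * h ^+ 2 - (2 * pi * complex.Im x) * h.
Proof.
case: tau x => [a b] [c d].
have -> : (2 : C) = (2 : R)%:C by apply: complexP => //=; rewrite ?addr0.
by rewrite expr2 ?cReD ?cReM ?cImM /= ?cReM ?cImM /= ?cReM ?cImM /=; ring.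
Qed.

Lemma gterm_summable (tau x : C) (h : int -> R) (w : int -> C) (M : R) :
  0 < complex.Im tau -> (forall j, (absz j)%:R <= `|h j| + 1) ->
  0 <= M -> (forall j, nrm (w j) <= M * (1 + h j ^+ 2)) ->
  exists S, hsum (fun j => w j * gterm tau x (h j)%:C) S.
Proof.
move=> tau0 hj M0 wb.
have [|K K0 HK] := @gaussian_bound (pi * complex.Im tau) (2 * pi * complex.Im x).
  by rewrite mulr_gt0 ?pi_gt0.
(* The factor 2 comes from [nrm_cexp], and [expR 1] pays for the 1 in the comparison of [absz j]
   with the frequency. *)
apply: (@hsum_int_geometric _ _ (2 * M * K * expR 1) (expR (-1))).
- by rewrite expR_ge0 expR_lt1; lra.
- by rewrite !mulr_ge0 ?expR_ge0 // ltW.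
move=> j; apply: le_trans (ler_nrmM _ _) _.
have A := nrm_cexp (pi%:C * 'i * tau * (h j)%:C ^+ 2 + 2 * pi%:C * 'i * x * (h j)%:C).
rewrite Re_gexponent in A.
apply: le_trans (ler_pM (nrm_ge0 _) (nrm_ge0 _) (wb j) A) _.
set E := expR _; have H := HK (h j); rewrite -/E in H.
have B : expR (- `|h j|) <= expR 1 * expR (-1) ^+ absz j.
  rewrite -expRM_natl -expRD ler_expR; have := hj j; lra.
have D : K * expR (- `|h j|) <= K * (expR 1 * expR (-1) ^+ absz j).
  by rewrite ler_wpM2l // ltW.
have -> : M * (1 + h j ^+ 2) * (2 * E) = 2 * M * (E * (1 + h j ^+ 2)) by ring.
have -> : 2 * M * K * expR 1 * expR (-1) ^+ `|j|
   = 2 * M * (K * (expR 1 * expR (-1) ^+ absz j)) by ring.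
by rewrite ler_wpM2l ?mulr_ge0 //; apply: le_trans H D.
Qed.

(** The symmetric windows eventually contain any given finite set of integers. *)
Lemma hsum_clim (f : int -> C) S : hsum f S ->
  clim (fun M : nat => \sum_(k < (2 * M)%N) f (k%:Z - M%:Z)) = S.
Proof.
move=> /hsum_tail H.
have near (e : R) : 0 < e -> exists M0 : nat, forall M : nat, (M0 <= M)%N ->
    nrm (S - \sum_(k < (2 * M)%N) f (k%:Z - M%:Z)) <= e.
  move=> e0; have [s us Hs] := H e e0.
  (* The successor is needed because the window runs from -M to M - 1 and omits M. *)
  exists (\max_(j <- s) absz j).+1 => M MM.
  pose t := [seq (k%:Z - M%:Z)%R | k <- iota 0 (2 * M)].
  have -> : \sum_(k < (2 * M)%N) f (k%:Z - M%:Z) = \sum_(j <- t) f j.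
    rewrite /t big_map; have -> : iota 0 (2 * M) = index_iota 0 (2 * M).
      by rewrite /index_iota subn0.
    by rewrite big_mkord.
  apply: (Hs t _ _).1.
    by rewrite map_inj_uniq ?iota_uniq // => a b; lia.
  move=> j js; have : (absz j <= \max_(j <- s) absz j)%N.
    by apply: (@leq_bigmax_seq _ s xpredT (fun j : int => absz j) j).
  move=> jm; apply/mapP; exists (absz (j + M%:Z)%R); first by rewrite mem_iota; lia.
  by lia.
apply: complexP => /=; apply: cvg_lim => //; apply/cvgrPdist_le => e /near[M0 HM];
  exists M0 => // M /= MM; apply: le_trans (HM M MM).
  by rewrite -cReN -cReD; apply: ler_Re_nrm.
by rewrite -cImN -cImD; apply: ler_Im_nrm.
Qed.

Variable tau : C.
Hypothesis tau_gt0 : 0 < complex.Im tau.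

Definition halfint (j : int) : R := j%:~R + 2^-1.

Lemma realC_int (j : int) : (j%:~R : R)%:C = j%:~R :> C.
Proof. by rewrite rmorph_int. Qed.

Lemma realCD (a b : R) : (a + b)%:C = a%:C + b%:C :> C.
Proof. exact: rmorphD. Qed.

Lemma realCM (a b : R) : (a * b)%:C = a%:C * b%:C :> C.
Proof. exact: rmorphM. Qed.

Lemma realC_nat (k : nat) : (k%:R : R)%:C = k%:R :> C.
Proof. exact: rmorph_nat. Qed.

Lemma half_realC : (2^-1 : R)%:C = 2^-1 :> C.
Proof. by rewrite fmorphV /= rmorph_nat. Qed.

Lemma Im_half z : complex.Im (z / 2) = complex.Im z / 2.
Proof. by case: z => a b; rewrite -half_realC cImM /=; ring. Qed.

Lemma halfintC j : (halfint j)%:C = j%:~R + 2^-1 :> C.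
Proof. by rewrite /halfint realCD realC_int half_realC. Qed.

Lemma absz_halfint j : (absz j)%:R <= `|halfint j| + 1.
Proof.
rewrite /halfint; case: j => k.
  by rewrite /= ger0_norm ?addr_ge0 ?ler0n ?invr_ge0 //; lra.
have -> : (Negz k)%:~R = - (k%:R + 1) :> R.
  by rewrite NegzE mulrNz -[k.+1%:~R]/(k.+1%:R) -(natr1 k).
have k0 := ler0n R k; rewrite ler0_norm; last by lra.
by rewrite /= -(natr1 k); lra.
Qed.

Lemma theta_termE z j : theta_term tau z j = gterm tau (z + 2^-1) (halfint j)%:C.
Proof.
rewrite /theta_term /gterm halfintC.
by congr cexp; ring.
Qed.

Lemma theta_hsum z :
  hsum (fun j => gterm tau (z + 2^-1) (halfint j)%:C) (- theta tau z).
Proof.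
have [|||S HS] := @gterm_summable tau (z + 2^-1) halfint (fun=> 1) 1 tau_gt0.
- exact: absz_halfint.
- by [].
- by move=> j; rewrite nrm_real normr1 mul1r lerDl sqr_ge0.
have H : hsum (fun j => gterm tau (z + 2^-1) (halfint j)%:C) S.
  by apply: eq_hsum HS => j; rewrite mul1r.
suff -> : theta tau z = - S by rewrite opprK.
rewrite /theta; congr (- _); apply: hsum_clim.
by apply: eq_hsum H => j; rewrite theta_termE.
Qed.

(** The modulus is halved because h^2 + h'^2 = ((h + h')^2 + (h - h')^2) / 2, while h(x + y) + h'(x
    - y) = (h + h') x + (h - h') y: the new frequencies h + h' and h - h' go with x and y
    separately. *)
Lemma even_hsum x : exists A,
  hsum (fun s : int => gterm (tau / 2) x (2 * s%:~R)) A.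
Proof.
have [||||S HS] := @gterm_summable (tau / 2) x (fun s => 2 * s%:~R) (fun=> 1) 1.
- by rewrite Im_half divr_gt0.
- by move=> j; rewrite normrM -intr_norm (ger0_norm (ler0n _ _)) -natr_absz; have := ler0n R (absz j); lra.
- by [].
- by move=> j; rewrite nrm_real normr1 mul1r lerDl sqr_ge0.
exists S; apply: eq_hsum HS => j.
by rewrite mul1r realCM realC_int realC_nat.
Qed.

Lemma odd_hsum x : exists B,
  hsum (fun s : int => gterm (tau / 2) x (2 * s%:~R + 1)) B.
Proof.
have [||||S HS] := @gterm_summable (tau / 2) x (fun s => 2 * s%:~R + 1) (fun=> 1) 1.
- by rewrite Im_half divr_gt0.
- move=> j; have -> : (2 * j%:~R + 1 : R) = (2 * j + 1)%:~R by rewrite intrD intrM.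
  by rewrite -intr_norm -natr_absz natr1 ler_nat; lia.
- by [].
- by move=> j; rewrite nrm_real normr1 mul1r lerDl sqr_ge0.
exists S; apply: eq_hsum HS => j.
by rewrite mul1r realCD realCM realC_int realC_nat.
Qed.

(** For the pair (j, k), the integers j + k + 1 and j - k have opposite parity. They are 2s + 1 and
    2t in the left summand, 2s and 2t + 1 in the right one. *)
Definition parity_split (u : int * int + int * int) : int * int :=
  match u with
  | inl (s, t) => (s + t, s - t)
  | inr (s, t) => (s + t, s - t - 1)
  end.

Definition parity_merge (v : int * int) : int * int + int * int :=
  let: (j, k) := v in
  if (2 %| j + k)%Z then inl (divz (j + k) 2, divz (j - k) 2)
  else inr (divz (j + k + 1) 2, divz (j - k - 1) 2).

Lemma parity_splitK : cancel parity_split parity_merge.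
Proof.
case=> -[s t] /=; case: ifP => h.
- by congr (inl (_, _)); lia.
- by exfalso; lia.
- by exfalso; lia.
- by congr (inr (_, _)); lia.
Qed.

Lemma parity_mergeK : cancel parity_merge parity_split.
Proof. by case=> j k /=; case: ifP => h /=; congr (_, _); lia. Qed.

(* With m = j + k + 1 and l = j - k for the two summation indices, the product
   of two theta series splits according to the parity of m. *)
Lemma theta_bilinear : exists A B : C -> C, forall x y,
  theta tau (x + y) * theta tau (x - y) = A x * B y - B x * A y.
Proof.
have [A HA] := choice even_hsum; have [B HB] := choice odd_hsum.
exists A, B => x y.
have H := hsumM (theta_hsum (x + y)) (theta_hsum (x - y)).
have := hsum_reindex parity_splitK parity_mergeK H.
rewrite mulrNN => /hsum_unique; apply.
rewrite (addrC (A x * B y)); apply: hsum_sum_type.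
  apply: eq_hsum (hsumN (hsumM (HB x) (HA y))) => -[s t] /=.
  rewrite /gterm -!cexpD !halfintC !intrD.
  (* The two shifts by 1/2 in theta contribute exp(pi i m) with m = j + k + 1. Here m = 2s + 1,
     whence the minus sign; in the other summand m = 2s and only full periods remain. *)
  rewrite -cexp_antiperiod -[LHS](cexp_period _ s).
  by congr cexp; rewrite mulrNz; field.
apply: eq_hsum (hsumM (HA x) (HB y)) => -[s t] /=.
rewrite /gterm -!cexpD !halfintC !intrD.
rewrite -[LHS](cexp_period _ s).
by congr cexp; rewrite !mulrNz; field.
Qed.

(* Antisymmetry in [theta_bilinear] gives theta(s) (theta(d) + theta(-d)) = 0 for all s, d. *)
Lemma thetaN x : theta tau (- x) = - theta tau x.
Proof.
have [A [B H]] := theta_bilinear.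
have anti s d : theta tau s * (theta tau d + theta tau (- d)) = 0.
  have := H ((s + d) / 2) ((s - d) / 2); have := H ((s - d) / 2) ((s + d) / 2).
  have -> : (s - d) / 2 + (s + d) / 2 = s by field.
  have -> : (s + d) / 2 + (s - d) / 2 = s by field.
  have -> : (s - d) / 2 - (s + d) / 2 = - d by field.
  have -> : (s + d) / 2 - (s - d) / 2 = d by field.
  by rewrite mulrDr => -> ->; ring.
(* [anti] yields oddness only after cancelling a nonzero value: s = d = x serves if theta(x) is
   nonzero, and otherwise s = -x, d = x gives theta(-x)^2 = 0. *)
have [h|h] := eqVneq (theta tau x) 0.
  have [h'|h'] := eqVneq (theta tau (- x)) 0; first by rewrite h h' oppr0.
  have := anti (- x) x; rewrite h add0r => /eqP; rewrite mulf_eq0 orbb.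
  by rewrite (negbTE h').
have := anti x x => /eqP; rewrite mulf_eq0 (negbTE h) /= addrC addr_eq0.
by move/eqP.
Qed.

Lemma theta0 : theta tau 0 = 0.
Proof.
have := thetaN 0; rewrite oppr0 => /eqP; rewrite -addr_eq0 -mulr2n mulrn_eq0.
by move/eqP.
Qed.

(** Each pair theta(x + y) theta(x - y) is the 2 by 2 minor of the vectors (A x, B x) and (A y, B
    y); four vectors in the plane satisfy this relation. *)
Lemma weierstrass x y u v :
  theta tau (x + y) * theta tau (x - y) * (theta tau (u + v) * theta tau (u - v))
  - theta tau (x + u) * theta tau (x - u) * (theta tau (y + v) * theta tau (y - v))
  + theta tau (x + v) * theta tau (x - v) * (theta tau (y + u) * theta tau (y - u))
  = 0.
Proof. have [A [B H]] := theta_bilinear; rewrite !H; ring. Qed.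

End ThetaAddition.

(** * Derivatives along the real direction and the addition law for [E1] *)

Section RealDirectionDerivatives.
Variable R : realType.
Local Notation C := R[i].
Local Open Scope complex_scope.
Implicit Types (f g : R -> C) (d e : C).

Lemma is_derive0_quadratic (f : R -> R) (d K : R) :
  (forall t, `|f t - f 0 - t * d| <= K * t ^+ 2) -> is_derive (0 : R) 1 f d.
Proof.
move=> H.
have K0 : 0 <= K.
  by have := H 1; rewrite expr1n mulr1 => /(le_trans _); apply.
suff L : ((fun h : R => h^-1 *: ((f \o shift 0) (h *: 1) - f 0)) @ (0 : R)^' --> d)%classic.
  by apply: DeriveDef; [apply/cvg_ex; exists d|apply: cvg_lim].
apply/cvgrPdist_le => e e0.
(* [K + 1] instead of [K], which may be 0. *)
have k0 : 0 < e / (K + 1) by rewrite divr_gt0 //; lra.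
exists (e / (K + 1)) => // h; rewrite /ball_ /= sub0r normrN => hk h0.
rewrite /= [h *: 1]mulr1 addr0 [h^-1 *: _]mulrC distrC.
have -> : (f h - f 0) / h - d = (f h - f 0 - h * d) / h by field.
rewrite normrM normfV ler_pdivrMr ?normr_gt0 //.
apply: le_trans (H h) _; rewrite -[h ^+ 2]real_normK ?num_real //.
rewrite expr2 mulrA ler_wpM2r //.
move: hk; rewrite ltr_pdivlMr; last by lra.
by have := normr_ge0 h; nra.
Qed.

(** A relation, because [cderiv] has a value even where no derivative exists; [cdiff] also carries
    differentiability, which the rules of calculus require. *)
Definition cdiff (f : R -> C) (d : C) : Prop :=
  is_derive (0 : R) 1 (fun t => complex.Re (f t)) (complex.Re d) /\
  is_derive (0 : R) 1 (fun t => complex.Im (f t)) (complex.Im d).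

Lemma cdiff_cderiv (f : C -> C) (z d : C) :
  cdiff (fun t => f (z + t%:C)) d -> cderiv f z = d.
Proof.
by move=> [H1 H2]; apply: complexP; rewrite /cderiv /= derive1E derive_val.
Qed.

Lemma cdiff_unique f d e : cdiff f d -> cdiff f e -> d = e.
Proof.
move=> [H1 H2] [H1' H2']; apply: complexP.
  by rewrite -(@derive_val _ _ _ _ _ _ _ H1) -(@derive_val _ _ _ _ _ _ _ H1').
by rewrite -(@derive_val _ _ _ _ _ _ _ H2) -(@derive_val _ _ _ _ _ _ _ H2').
Qed.

Lemma eq_cdiff f g d : f =1 g -> cdiff f d -> cdiff g d.
Proof. by move=> /funext ->. Qed.

Lemma cdiff_quadratic f d (K : R) :
  (forall t, nrm (f t - f 0 - t%:C * d) <= K * t ^+ 2) -> cdiff f d.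
Proof.
move=> H; split; apply: (@is_derive0_quadratic _ _ K) => t; apply: le_trans (H t).
  apply: le_trans (ler_Re_nrm _); rewrite !(cReD, cReN) cReM /=.
  by rewrite mul0r subr0.
apply: le_trans (ler_Im_nrm _); rewrite !(cImD, cImN) cImM /=.
by rewrite mul0r addr0.
Qed.

Lemma cdiff_cst (a : C) : cdiff (fun=> a) 0.
Proof. by split; apply: is_derive_cst. Qed.

Lemma cdiffB f g d e : cdiff f d -> cdiff g e -> cdiff (fun t => f t - g t) (d - e).
Proof.
move=> [H1 H2] [H3 H4]; split.
  rewrite cReD cReN; rewrite (_ : (fun t => _) =
    (fun t => complex.Re (f t)) - (fun t => complex.Re (g t))); first exact: is_deriveB.
  by apply/funext => t; rewrite cReD cReN.
rewrite cImD cImN; rewrite (_ : (fun t => _) =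
  (fun t => complex.Im (f t)) - (fun t => complex.Im (g t))); first exact: is_deriveB.
by apply/funext => t; rewrite cImD cImN.
Qed.

Lemma cdiffM f g d e : cdiff f d -> cdiff g e ->
  cdiff (fun t => f t * g t) (d * g 0 + f 0 * e).
Proof.
move=> [H1 H2] [H3 H4]; split.
  rewrite (_ : (fun t => _) =
    ((fun t => complex.Re (f t)) * (fun t => complex.Re (g t)))
    - ((fun t => complex.Im (f t)) * (fun t => complex.Im (g t)))).
    apply: (is_derive_eq (is_deriveB (is_deriveM H1 H3) (is_deriveM H2 H4))).
    by rewrite cReD !cReM /GRing.scale /=; ring.
  by apply/funext => t; rewrite cReM.
rewrite (_ : (fun t => _) =
  ((fun t => complex.Re (f t)) * (fun t => complex.Im (g t)))
  + ((fun t => complex.Im (f t)) * (fun t => complex.Re (g t)))).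
  apply: (is_derive_eq (is_deriveD (is_deriveM H1 H4) (is_deriveM H2 H3))).
  by rewrite cImD !cImM /GRing.scale /=; ring.
by apply/funext => t; rewrite cImM.
Qed.

Lemma sqr_parts_neq0 (x : C) : x != 0 ->
  complex.Re x * complex.Re x + complex.Im x * complex.Im x != 0.
Proof.
apply: contra => h; case: x h => a b /=.
by rewrite -!expr2 paddr_eq0 ?sqr_ge0 // !sqrf_eq0 => /andP[/eqP -> /eqP ->].
Qed.

Lemma cReV (x : C) : complex.Re x^-1
  = complex.Re x / (complex.Re x * complex.Re x + complex.Im x * complex.Im x).
Proof. by case: x => a b; rewrite /= !expr2. Qed.

Lemma cImV (x : C) : complex.Im x^-1
  = - complex.Im x / (complex.Re x * complex.Re x + complex.Im x * complex.Im x).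
Proof. by case: x => a b; rewrite /= !expr2 mulNr. Qed.

(** With f = a + ib, the parts of 1/f are a / (a^2 + b^2) and -b / (a^2 + b^2), so the real product
    and inverse rules suffice. *)
Lemma cdiffV f d : f 0 != 0 -> cdiff f d ->
  cdiff (fun t => (f t)^-1) (- d / f 0 ^+ 2).
Proof.
move=> f0 [H1 H2].
set a := (fun t => complex.Re (f t)) in H1; set b := (fun t => complex.Im (f t)) in H2.
have n0 := sqr_parts_neq0 f0.
have D := is_deriveD (is_deriveM H1 H1) (is_deriveM H2 H2).
have V := is_deriveV (n0 : (a * a + b * b) 0 != 0) D.
have dE : - d / f 0 ^+ 2 = - (d * ((f 0)^-1 * (f 0)^-1)) by field.
have nE : (a * a + b * b) 0 = a 0 * a 0 + b 0 * b 0 by [].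
have bN : (- b) 0 = - b 0 by [].
rewrite dE; split.
  rewrite (_ : (fun t => _) = a * (fun t => ((a * a + b * b) t)^-1)).
    apply: (is_derive_eq (is_deriveM H1 V)).
    rewrite cReN !cReM ?cImM !(cReV, cImV) /GRing.scale /= -/(a 0) -/(b 0) nE.
    by field; apply: n0.
  by apply/funext => t; rewrite cReV.
rewrite (_ : (fun t => _) = (- b) * (fun t => ((a * a + b * b) t)^-1)).
  apply: (is_derive_eq (is_deriveM (is_deriveN H2) V)).
  rewrite cImN !cImM ?cReM !(cReV, cImV) /GRing.scale /= -/(a 0) -/(b 0) nE bN.
  by field; apply: n0.
by apply/funext => t; rewrite cImV.
Qed.

Lemma mean_value0 (f df : R -> R) (x : R) :
  (forall y : R, is_derive y (1 : R) f (df y)) ->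
  exists2 c, `|c| <= `|x| & f x - f 0 = df c * x.
Proof.
move=> H.
have cf a b : {within `[a, b], continuous f}%classic.
  by apply: derivable_within_continuous => y _; apply: (@ex_derive _ _ _ _ _ _ _ (H y)).
have [x0|x0] := leP 0 x.
  have [c] := MVT_segment x0 (fun y _ => H y) (@cf 0 x).
  rewrite in_itv /= subr0 => /andP[c0 cx] E; exists c => //.
  by rewrite !ger0_norm.
have [c] := MVT_segment (ltW x0) (fun y _ => H y) (@cf x 0).
rewrite in_itv /= sub0r => /andP[c0 cx] E; exists c.
  by rewrite !ler0_norm ?lerN2 // ltW.
by rewrite -opprB E mulrN opprK.
Qed.

Lemma ler_norm_sin (x : R) : `|sin x| <= `|x|.
Proof.
have [c _] := mean_value0 x (@is_derive_sin R).
rewrite sin0 subr0 => ->; rewrite normrM ler_piMl //; exact: cos_max.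
Qed.

(** By the mean value theorem cos x - 1 = -x sin c with |c| at most |x|. Bounding |sin c| by 1 or by
    |c| gives the two estimates. *)
Lemma cosB1_bound (x : R) : `|cos x - 1| <= `|x| /\ `|cos x - 1| <= x ^+ 2.
Proof.
have [c cx] := mean_value0 x (@is_derive_cos R).
rewrite cos0 => ->; rewrite normrM normrN; split.
  by rewrite ler_piMl //; apply: sin_max.
rewrite -[x ^+ 2]real_normK ?num_real // expr2 ler_wpM2r //.
exact: le_trans (ler_norm_sin c) cx.
Qed.

Lemma sinBx_bound (x : R) : `|sin x - x| <= x ^+ 2.
Proof.
have H (y : R) : is_derive y 1 (sin - id : R -> R) (cos y - 1).
  exact: is_deriveB.
have [c cx E] := mean_value0 x H.
have {E} : sin x - x - (sin 0 - 0) = (cos c - 1) * x := E.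
rewrite sin0 !subr0 => ->; rewrite normrM -[x ^+ 2]real_normK ?num_real // expr2 ler_wpM2r //.
exact: le_trans (cosB1_bound c).1 cx.
Qed.

(** The bound holds for all real y, not only small ones; this uniformity lets it be summed over the
    unbounded frequencies of theta. *)
Lemma cexp_remainder (y : R) :
  nrm (cexp ('i * y%:C) - 1 - 'i * y%:C) <= 2 * y ^+ 2.
Proof.
have -> : 'i * y%:C = Complex 0 y :> C by apply: complexP; rewrite ?cReM ?cImM /=; ring.
rewrite cexpE expR0 /nrm /= !mul1r !subr0.
by have := (cosB1_bound y).2; have := sinBx_bound y; lra.
Qed.

Lemma cdiff_cexp (v k : C) : cdiff (fun t => cexp (v + t%:C * k)) (k * cexp v).
Proof.
suff H : cdiff (fun t => cexp (t%:C * k)) k.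
  apply: (@eq_cdiff (fun t => cexp v * cexp (t%:C * k))) => [t|]; first by rewrite cexpD.
  have := cdiffM (cdiff_cst (cexp v)) H.
  by rewrite mul0r add0r mulrC.
case: k => a b.
have E t : cexp (t%:C * Complex a b) = Complex (expR (t * a) * cos (t * b)) (expR (t * a) * sin (t * b)).
  rewrite -cexpE; congr cexp; by apply: complexP; rewrite ?cReM ?cImM /=; ring.
have L (m : R) : is_derive (0 : R) 1 (fun t => t * m) m.
  have := is_deriveM (is_derive_id (0 : R) (1 : R)) (is_derive_cst m (0 : R) (1 : R)).
  by move=> /is_derive_eq; apply; rewrite /GRing.scale /=; ring.
have He := @is_derive1_comp R expR (fun t => t * a) 0 _ _ (is_derive_expR _) (L a).
have Hc := @is_derive1_comp R cos (fun t => t * b) 0 _ _ (is_derive_cos _) (L b).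
have Hs := @is_derive1_comp R sin (fun t => t * b) 0 _ _ (is_derive_sin _) (L b).
split.
  rewrite (_ : (fun t => _) = (expR \o (fun t => t * a)) * (cos \o (fun t => t * b))).
    apply: (is_derive_eq (is_deriveM He Hc)).
    by rewrite /GRing.scale /= !mul0r expR0 cos0 sin0; ring.
  by apply/funext => t; rewrite E.
rewrite (_ : (fun t => _) = (expR \o (fun t => t * a)) * (sin \o (fun t => t * b))).
  apply: (is_derive_eq (is_deriveM He Hs)).
  by rewrite /GRing.scale /= !mul0r expR0 cos0 sin0; ring.
by apply/funext => t; rewrite E.
Qed.

Lemma nrm_realM (r : R) (x : C) : nrm (r%:C * x) = `|r| * nrm x.
Proof. by case: x => a b; rewrite /nrm cReM cImM /= !mul0r subr0 addr0 !normrM; ring. Qed.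

Lemma hsum_le (T : eqType) (f : T -> C) S (M : R) : hsum f S ->
  (forall s, uniq s -> \sum_(x <- s) nrm (f x) <= M) -> nrm S <= M.
Proof.
move=> H fM; apply/ler_addgt0Pr => e e0; have [s us [h _]] := H e e0.
have := ler_nrmD (S - \sum_(x <- s) f x) (\sum_(x <- s) f x); rewrite subrK.
by have := ler_nrm_sum s f; have := fM s us; lra.
Qed.

Variable tau : C.
Hypothesis tau_gt0 : 0 < complex.Im tau.

(** A real shift t multiplies the summand of frequency h by exp(2 pi i h t). Its second-order
    remainder is thus of size h^2 t^2 times the unshifted summand, uniformly in t, and the series
    weighted by h^2 converges absolutely. *)
Lemma theta_quadratic z : exists D : C, exists K : R, forall t,
  nrm (theta tau (z + t%:C) - theta tau z - t%:C * D) <= K * t ^+ 2.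
Proof.
pose G j := gterm tau (z + 2^-1) (halfint R j)%:C.
have h2 j : 0 <= halfint R j ^+ 2 by apply: sqr_ge0.
(* The termwise derivative; its weight 2 pi |h| is at most 2 pi (1 + h^2). *)
have [||D0 HD] := @gterm_summable _ tau (z + 2^-1) (halfint R)
    (fun j => 'i * (2 * pi * halfint R j)%:C) (2 * pi) tau_gt0 (@absz_halfint R).
- by rewrite mulr_ge0 // pi_ge0.
- move=> j.
  have -> : 'i * (2 * pi * halfint R j)%:C = Complex 0 (2 * pi * halfint R j) :> C.
    by apply: complexP; rewrite ?cReM ?cImM /=; ring.
  rewrite /nrm /= normr0 add0r normrM ger0_norm ?mulr_ge0 ?pi_ge0 //.
  rewrite ler_wpM2l ?mulr_ge0 ?pi_ge0 //.
  have := sqr_ge0 (`|halfint R j| - 1); rewrite -[halfint R j ^+ 2]real_normK ?num_real //.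
  have := normr_ge0 (halfint R j); nra.
have [||Q HQ] := @gterm_summable _ tau (z + 2^-1) (halfint R)
    (fun j => (halfint R j ^+ 2)%:C) 1 tau_gt0 (@absz_halfint R).
- by [].
- by move=> j; rewrite nrm_real ger0_norm //; lra.
have [M M0 HM] := hsum_bounded HQ.
pose w : R := 2 * (2 * pi) ^+ 2.
(* The sign is that of theta, which is minus the series. In [w], the 2 is from [cexp_remainder] and
   the square from y = 2 pi h t. *)
exists (- D0), (w * M) => t.
have HE := hsumD (hsumD (theta_hsum tau_gt0 (z + t%:C)) (hsumN (theta_hsum tau_gt0 z)))
  (hsumN (hsumZ t%:C HD)).
have -> : theta tau (z + t%:C) - theta tau z - t%:C * - D0
  = - (- theta tau (z + t%:C) + - - theta tau z + - (t%:C * D0)) by ring.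
rewrite nrmN; apply: hsum_le HE _ => s us /=.
apply: (@le_trans _ _ (\sum_(j <- s) w * t ^+ 2 * (halfint R j ^+ 2 * nrm (G j)))).
  apply: ler_sum => j _; set h := halfint R j.
  pose y := 2 * pi * h * t.
  have -> : gterm tau (z + t%:C + 2^-1) h%:C + - gterm tau (z + 2^-1) h%:C
      + - (t%:C * ('i * (2 * pi * h)%:C * gterm tau (z + 2^-1) h%:C))
    = (cexp ('i * y%:C) - 1 - 'i * y%:C) * G j.
    rewrite /G -/h; have -> : gterm tau (z + t%:C + 2^-1) h%:C
       = cexp ('i * y%:C) * gterm tau (z + 2^-1) h%:C.
      by rewrite /gterm -cexpD; congr cexp; rewrite /y !realCM realC_nat; ring.
    by rewrite /y !realCM realC_nat; ring.
  apply: le_trans (ler_nrmM _ _) _.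
  have -> : w * t ^+ 2 * (h ^+ 2 * nrm (G j)) = 2 * y ^+ 2 * nrm (G j).
    by rewrite /w /y; ring.
  by rewrite ler_wpM2r ?nrm_ge0 // cexp_remainder.
rewrite -mulr_sumr.
have -> : w * M * t ^+ 2 = w * t ^+ 2 * M by ring.
have w0 : 0 <= w * t ^+ 2 by apply: mulr_ge0 (sqr_ge0 _); apply: mulr_ge0 (sqr_ge0 _).
apply: (ler_wpM2l w0).
apply: le_trans (HM s us); apply: ler_sum => j _.
by rewrite nrm_realM ger0_norm.
Qed.

(** Moving one coordinate moves a difference of coordinates with some real speed [e] in {-1, 0, 1};
    speed -1 also yields the evenness of [theta']. *)
Lemma cdiff_theta z (e : R) :
  cdiff (fun t => theta tau (z + (e * t)%:C)) (e%:C * theta' tau z).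
Proof.
have [D [K H]] := theta_quadratic z.
have z0 : z + 0%:C = z by rewrite addr0.
have -> : theta' tau z = D.
  apply: cdiff_cderiv; apply: (@cdiff_quadratic _ _ K) => t; rewrite z0; exact: H.
apply: (@cdiff_quadratic _ _ (K * e ^+ 2)) => t.
rewrite mulr0 z0; have -> : t%:C * (e%:C * D) = (e * t)%:C * D by rewrite realCM; ring.
by apply: le_trans (H _) _; rewrite exprMn mulrA.
Qed.

(* Differentiate [weierstrass] at x = y + t with respect to t at t = 0. *)
Lemma theta_derivative_identity (a b c d : C) : a + b = c + d ->
  theta' tau 0 * theta tau (a + b) * theta tau (a - c) * theta tau (a - d)
  = (theta' tau a * theta tau b + theta tau a * theta' tau b) * (theta tau c * theta tau d)
  - (theta' tau c * theta tau d + theta tau c * theta' tau d) * (theta tau a * theta tau b).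
Proof.
move=> abcd.
have dE : d = a + b - c by rewrite abcd addrAC subrr add0r.
(* Chosen so that y + u, y - u, y + v, y - v are a, b, c, d; the last two use a + b = c + d. *)
pose y := (a + b) / 2; pose u := (a - b) / 2; pose v := (c - d) / 2.
have H1 (z : C) : cdiff (fun t => theta tau (z + t%:C)) (theta' tau z).
  have := cdiff_theta z 1; rewrite mul1r; apply: eq_cdiff => t; by rewrite mul1r.
have L := cdiffM (cdiffM (H1 (a + b)) (H1 0))
  (cdiff_cst (theta tau (a - d) * theta tau (a - c))).
have M := cdiffB
  (cdiffM (cdiffM (H1 a) (H1 b)) (cdiff_cst (theta tau c * theta tau d)))
  (cdiffM (cdiffM (H1 c) (H1 d)) (cdiff_cst (theta tau a * theta tau b))).
have E : (fun t : R => theta tau (a + b + t%:C) * theta tau (0 + t%:C)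
      * (theta tau (a - d) * theta tau (a - c)))
   =1 (fun t : R => theta tau (a + t%:C) * theta tau (b + t%:C) * (theta tau c * theta tau d)
      - theta tau (c + t%:C) * theta tau (d + t%:C) * (theta tau a * theta tau b)).
  move=> t; have := weierstrass tau_gt0 (y + t%:C) y u v.
  have -> : y + t%:C + y = a + b + t%:C by rewrite /y; field.
  have -> : y + t%:C - y = 0 + t%:C by rewrite /y; field.
  have -> : u + v = a - d by rewrite /u /v dE; field.
  have -> : u - v = a - c by rewrite /u /v dE; field.
  have -> : y + t%:C + u = a + t%:C by rewrite /y /u; field.
  have -> : y + t%:C - u = b + t%:C by rewrite /y /u; field.
  have -> : y + t%:C + v = c + t%:C by rewrite /y /v dE; field.
  have -> : y + t%:C - v = d + t%:C by rewrite /y /v dE; field.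
  have -> : y + u = a by rewrite /y /u; field.
  have -> : y - u = b by rewrite /y /u; field.
  have -> : y + v = c by rewrite /y /v dE; field.
  have -> : y - v = d by rewrite /y /v dE; field.
  move: (theta tau (a + b + _)) (theta tau (0 + _)) (theta tau (a - d)) (theta tau (a - c))
    (theta tau (a + _)) (theta tau (b + _)) (theta tau (c + _)) (theta tau (d + _))
    (theta tau a) (theta tau b) (theta tau c) (theta tau d) => {L M H1}.
  move=> X1 X2 X3 X4 X5 X6 X7 X8 X9 X10 X11 X12 /eqP.
  by rewrite -addrA addr_eq0 => /eqP ->; ring.
(* The factor theta(x - y) = theta(t) vanishes at t = 0, so on the left only its own derivative
   [theta' tau 0] survives. *)
have := cdiff_unique (eq_cdiff E L) M; rewrite !addr0 (theta0 tau_gt0).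
move: (theta' tau 0) (theta' tau a) (theta' tau b) (theta' tau c) (theta' tau d)
  (theta' tau _) (theta tau (a + b)) (theta tau (a - d)) (theta tau (a - c))
  (theta tau a) (theta tau b) (theta tau c) (theta tau d) => {L M H1 E}.
move=> D0 Da Db Dc Dd Dab Tab Tad Tac Ta Tb Tc Td h.
by apply: etrans (etrans _ h) _; ring.
Qed.

(** This turns a combination of [E1] values into a single theta quotient; both identities for [phi]
    below rest on it. *)
Lemma E1_sum (a b c d : C) : a + b = c + d ->
  theta tau a != 0 -> theta tau b != 0 -> theta tau c != 0 -> theta tau d != 0 ->
  E1 tau a + E1 tau b - E1 tau c - E1 tau d
  = theta' tau 0 * theta tau (a + b) * theta tau (a - c) * theta tau (a - d)
    / (theta tau a * theta tau b * theta tau c * theta tau d).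
Proof.
move=> abcd; have := theta_derivative_identity abcd; rewrite /E1.
move: (theta' tau 0) (theta' tau a) (theta' tau b) (theta' tau c) (theta' tau d)
  (theta tau (a + b)) (theta tau (a - c)) (theta tau (a - d))
  (theta tau a) (theta tau b) (theta tau c) (theta tau d).
move=> D0 Da Db Dc Dd Tab Tac Tad Ta Tb Tc Td -> a0 b0 c0 d0.
by field; rewrite a0 b0 c0 d0.
Qed.

Lemma realCN (a : R) : (- a)%:C = - a%:C :> C.
Proof. exact: rmorphN. Qed.

Lemma theta'N x : theta' tau (- x) = theta' tau x.
Proof.
have H := cdiff_theta (- x) (-1).
have := cdiffB (cdiff_cst 0) (cdiff_theta x 1).
have E : (fun t : R => 0 - theta tau (x + (1 * t)%:C)) =1 (fun t => theta tau (- x + (-1 * t)%:C)).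
  move=> t; rewrite sub0r -(thetaN tau_gt0); congr theta.
  by rewrite !realCM opprD; congr (_ + _); apply: complexP => /=; ring.
move=> /(eq_cdiff E) /(cdiff_unique H).
move: (theta' tau (- x)) (theta' tau x) => A B.
by rewrite realCN mulN1r mul1r sub0r => /oppr_inj.
Qed.

Lemma E1N x : E1 tau (- x) = - E1 tau x.
Proof. by rewrite /E1 theta'N (thetaN tau_gt0) invrN mulrN. Qed.

End RealDirectionDerivatives.

(** * Identities and logarithmic derivatives of [phi] *)

Section KroneckerFunction.
Variable R : realType.
Local Notation C := R[i].
Local Open Scope complex_scope.
Variable tau : C.
Hypothesis tau_gt0 : 0 < complex.Im tau.
Local Notation th := (theta tau).

(** [E1_sum] for (z - w) + (x - y) = (z + x) + (-(w + y)) writes the bracket as one theta quotient;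
    both sides are then the same product. *)
Lemma phi_product (x y z w : C) :
  th z != 0 -> th w != 0 -> th x != 0 -> th y != 0 ->
  th (z - w) != 0 -> th (x - y) != 0 -> th (z + x) != 0 -> th (w + y) != 0 ->
  phi tau (z - w) (x - y) * phi tau z y * phi tau w x
  = phi tau z x * phi tau w y
    * (E1 tau (z - w) + E1 tau (x - y) - E1 tau (z + x) + E1 tau (w + y)).
Proof.
move=> z0 w0 x0 y0 zw0 xy0 zx0 wy0.
have wyN : th (- (w + y)) = - th (w + y) by apply: thetaN.
have wyN0 : th (- (w + y)) != 0 by rewrite wyN oppr_eq0.
have abcd : (z - w) + (x - y) = (z + x) + - (w + y) by ring.
have := E1_sum tau_gt0 abcd zw0 xy0 zx0 wyN0.
rewrite (E1N tau_gt0) opprK => ->; rewrite /phi wyN.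
have -> : z - w - (z + x) = - (w + x) by ring.
have -> : z - w - - (w + y) = z + y by ring.
rewrite (thetaN tau_gt0).
move: (theta' tau 0) (th (z - w + (x - y))) (th (w + x)) (th (z + y))
  (th z) (th w) (th x) (th y) (th (z - w)) (th (x - y)) (th (z + x)) (th (w + y))
  z0 w0 x0 y0 zw0 xy0 zx0 wy0 {wyN wyN0 abcd}.
move=> D t1 t2 t3 t4 t5 t6 t7 t8 t9 t10 t11 h1 h2 h3 h4 h5 h6 h7 h8.
by field; rewrite h1 h2 h3 h4 h5 h6 h7 h8.
Qed.

(** Over a common denominator the two products on the left are two terms of [weierstrass]. The third
    term is the right side once [E1_sum] has evaluated its bracket. *)
Lemma phi_exchange (s u al be z w : C) : u + al = s + be ->
  th z != 0 -> th w != 0 -> th s != 0 -> th u != 0 -> th (z - w) != 0 ->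
  th al != 0 -> th be != 0 -> th (s + be) != 0 -> th (s - al) != 0 ->
  phi tau (z - w) al * phi tau z u * phi tau w s
  - phi tau (z - w) be * phi tau z s * phi tau w u
  = phi tau z (s + be) * phi tau w (s - al)
    * (E1 tau u + E1 tau al - E1 tau s - E1 tau be).
Proof.
move=> abcd z0 w0 s0 u0 zw0 al0 be0 sb0 sa0.
have uE : u = s + be - al by rewrite -abcd addrK.
have -> := E1_sum tau_gt0 abcd u0 al0 s0 be0.
have := weierstrass tau_gt0 ((z + w + u + s) / 2) ((z - w + be - al) / 2)
  ((z - w + al + be) / 2) ((z - w + al - be) / 2).
have -> : (z + w + u + s) / 2 + (z - w + be - al) / 2 = z + u by rewrite uE; field.
have -> : (z + w + u + s) / 2 - (z - w + be - al) / 2 = w + s by rewrite uE; field.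
have -> : (z - w + al + be) / 2 + (z - w + al - be) / 2 = z - w + al by field.
have -> : (z - w + al + be) / 2 - (z - w + al - be) / 2 = be by field.
have -> : (z + w + u + s) / 2 + (z - w + al + be) / 2 = z + (s + be) by rewrite uE; field.
have -> : (z + w + u + s) / 2 - (z - w + al + be) / 2 = w + (s - al) by rewrite uE; field.
have -> : (z - w + be - al) / 2 + (z - w + al - be) / 2 = z - w by field.
have -> : (z - w + be - al) / 2 - (z - w + al - be) / 2 = be - al by field.
have -> : (z + w + u + s) / 2 + (z - w + al - be) / 2 = z + s by rewrite uE; field.
have -> : (z + w + u + s) / 2 - (z - w + al - be) / 2 = w + u by rewrite uE; field.
have -> : (z - w + be - al) / 2 + (z - w + al + be) / 2 = z - w + be by field.
have -> : (z - w + be - al) / 2 - (z - w + al + be) / 2 = - al by field.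
rewrite /phi abcd (thetaN tau_gt0).
have -> : u - s = be - al by rewrite uE; ring.
have -> : u - be = s - al by rewrite uE; ring.
move: (theta' tau 0) (th (z + u)) (th (w + s)) (th (z - w + al))
  (th (z + (s + be))) (th (w + (s - al))) (th (be - al)) (th (z + s)) (th (w + u))
  (th (z - w + be)) (th z) (th w) (th s) (th u) (th (z - w)) (th al) (th be)
  (th (s + be)) (th (s - al)) z0 w0 s0 u0 zw0 al0 be0 sb0 sa0 {abcd uE}.
move=> D t1 t2 t3 t4 t5 t6 t7 t8 t9 t10 t11 t12 t13 t14 t15 t16 t17 t18
  h1 h2 h3 h4 h5 h6 h7 h8 h9 /eqP.
rewrite addr_eq0 subr_eq => /eqP W.
have V : t1 * t2 * (t3 * t16) - t7 * t8 * (t9 * t15) = t4 * t5 * (t14 * t6).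
  by rewrite W; ring.
(* Each of the three [phi] factors contributes one [theta' tau 0]; on the right the third comes from
   [E1_sum]. *)
transitivity (D ^+ 3 / (t14 * t15 * t16 * t10 * t11 * t12 * t13)
  * (t1 * t2 * (t3 * t16) - t7 * t8 * (t9 * t15))).
  by field; rewrite h1 h2 h3 h4 h5 h6 h7.
by rewrite V; field; rewrite h1 h2 h3 h4 h5 h6 h7 h8 h9.
Qed.

(** Logarithmic derivative in multiplied-out form: no branch of the logarithm is chosen, and
    products need no nonvanishing. *)
Definition logd (f : R -> C) (l : C) : Prop := cdiff f (f 0 * l).

Lemma eq_logd f g l : f =1 g -> logd f l -> logd g l.
Proof. by move=> /funext ->. Qed.

Lemma logd_cst a : logd (fun=> a) 0.
Proof. by rewrite /logd mulr0; apply: cdiff_cst. Qed.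

Lemma logdM f g l m : logd f l -> logd g m -> logd (fun t => f t * g t) (l + m).
Proof.
move=> H1 H2; have := cdiffM H1 H2; rewrite /logd.
by have -> : f 0 * l * g 0 + f 0 * (g 0 * m) = f 0 * g 0 * (l + m) by ring.
Qed.

Lemma logdV f l : f 0 != 0 -> logd f l -> logd (fun t => (f t)^-1) (- l).
Proof.
move=> f0 H; have := cdiffV f0 H; rewrite /logd.
by have -> : - (f 0 * l) / f 0 ^+ 2 = (f 0)^-1 * - l by field.
Qed.

Lemma logd_prod (I : Type) (r : seq I) (P : pred I) (f : I -> R -> C) (l : I -> C) :
  (forall i, P i -> logd (f i) (l i)) ->
  logd (fun t => \prod_(i <- r | P i) f i t) (\sum_(i <- r | P i) l i).
Proof.
move=> H; elim: r => [|i r IH].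
  rewrite big_nil; apply: eq_logd (logd_cst 1) => t; by rewrite big_nil.
rewrite big_cons; case: (boolP (P i)) => Pi; last first.
  by apply: eq_logd IH => t; rewrite big_cons (negbTE Pi).
by apply: eq_logd (logdM (H i Pi) IH) => t; rewrite big_cons Pi.
Qed.

Lemma logd_theta (g : R -> C) (u : C) (e : R) : th u != 0 ->
  (forall t, g t = u + (e * t)%:C) -> logd (fun t => th (g t)) (e%:C * E1 tau u).
Proof.
move=> u0 gE; rewrite /logd gE mulr0 addr0.
have -> : th u * (e%:C * E1 tau u) = e%:C * theta' tau u.
  by rewrite /E1; move: (theta' tau u) (th u) u0 => A B B0; field.
by apply: eq_cdiff (cdiff_theta tau_gt0 u e) => t; rewrite gE.
Qed.

Lemma logd_phi (g : R -> C) (z u : C) (e : R) :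
  th z != 0 -> th u != 0 -> th (z + u) != 0 ->
  (forall t, g t = u + (e * t)%:C) ->
  logd (fun t => phi tau z (g t)) (e%:C * (E1 tau (z + u) - E1 tau u)).
Proof.
move=> z0 u0 zu0 gE.
have H1 : logd (fun t => th (z + g t)) (e%:C * E1 tau (z + u)).
  by apply: logd_theta => // t; rewrite gE addrA.
have H2 : logd (fun t => th (g t)) (e%:C * E1 tau u) by apply: logd_theta.
have g0 : g 0 = u by rewrite gE mulr0 addr0.
have H3 : logd (fun t => (th z * th (g t))^-1) (- (0 + e%:C * E1 tau u)).
  by apply: logdV (logdM (logd_cst _) H2); rewrite g0 mulf_neq0.
have := logdM (logdM (logd_cst (theta' tau 0)) H1) H3; rewrite /phi.
move: (E1 tau (z + u)) (E1 tau u) => A B.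
by have -> : 0 + e%:C * A - (0 + e%:C * B) = e%:C * (A - B) by ring.
Qed.

End KroneckerFunction.

(** * Partial derivatives and Poisson brackets of the Lax entries *)

Lemma sum_delta_l (R : realType) (K : nat) (j : 'I_K) (F : 'I_K -> R[i]) :
  \sum_(r < K) (r == j)%:R * F r = F j.
Proof.
rewrite (bigD1 j) //= eqxx mul1r big1 ?addr0 // => r /negbTE ->.
by rewrite mul0r.
Qed.

Section LaxBrackets.
Variable R : realType.
Local Notation C := R[i].
Local Open Scope complex_scope.
Variables (N n : nat) (tau eta c : C).
Hypothesis tau_gt0 : 0 < complex.Im tau.
Hypothesis c_neq0 : c != 0.
Local Notation th := (theta tau).
Local Notation L := (Lmat tau eta c).
Implicit Types (X : phase R N n) (a b : 'I_n) (i j k l m : 'I_N).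

Lemma setc_shift (f : 'I_n -> 'I_N -> C) a i (t : R) b j :
  setc f a i (f a i + t%:C) b j
  = f b j + (((b == a) && (j == i))%:R * t)%:C.
Proof.
rewrite /setc; case: ifP => [/andP[/eqP -> /eqP ->]|_]; first by rewrite mul1r.
by rewrite mul0r addr0.
Qed.

Lemma dp_Lmat X a m b z k l :
  dp a m (fun Y => L Y b z k l) X = ((b == a) && (l == m))%:R * (L X b z k l / c).
Proof.
apply: cdiff_cderiv => /=; rewrite !mxE.
set K := (Y in Y * cexp _); pose e : R := ((b == a) && (l == m))%:R.
have := cdiffM (cdiff_cst K) (cdiff_cexp (X.1 b l / c) (e%:C / c)).
rewrite mul0r add0r.
have -> : K * (e%:C / c * cexp (X.1 b l / c))
    = ((b == a) && (l == m))%:R * (K * cexp (X.1 b l / c) / c).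
  by rewrite realC_nat; move: (cexp _) => T; move: (K) => K'; field.
apply: eq_cdiff => t; rewrite !mxE /= setc_shift; congr (_ * cexp _).
by rewrite -/e realCM mulrDl; congr (_ + _); field.
Qed.

(** Logarithmic derivative of L^b_kl in q^b_m through the own-site coordinates. The three lines come
    from [phi], from the numerator product and from the denominator product. *)
Definition own_logder X b z k l m : C :=
  - (l == m)%:R * (E1 tau (z + (X.2 (ord_pred b) k - X.2 b l + eta))
                   - E1 tau (X.2 (ord_pred b) k - X.2 b l + eta))
  + (l == m)%:R * \sum_(r < N) E1 tau (X.2 b l - X.2 (ord_pred b) r - eta)
  - \sum_(r < N | r != l) ((l == m)%:R - (r == m)%:R) * E1 tau (X.2 b l - X.2 b r).

(** The same in q^{b-1}_m. The last term is the numerator factor with index m, its sign turned by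
    oddness of [E1]; it will match [uplus] and [uminus], and the first term [s12] and [s21]. *)
Definition prev_logder X b z k l m : C :=
  (k == m)%:R * (E1 tau (z + (X.2 (ord_pred b) k - X.2 b l + eta))
                   - E1 tau (X.2 (ord_pred b) k - X.2 b l + eta))
  + E1 tau (X.2 (ord_pred b) m - X.2 b l + eta).

Lemma dq_Lmat X a m b z k l :
  th (- eta) != 0 -> th z != 0 ->
  (forall i j, i != j -> th (X.2 b i - X.2 b j) != 0) ->
  (forall i j, th (X.2 (ord_pred b) i - X.2 b j + eta) != 0) ->
  th (z + (X.2 (ord_pred b) k - X.2 b l + eta)) != 0 ->
  dq a m (fun Y => L Y b z k l) X
  = L X b z k l * ((b == a)%:R * own_logder X b z k l m
                   + (ord_pred b == a)%:R * prev_logder X b z k l m).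
Proof.
move=> eta0 z0 qq0 Qq0 zQ0.
(* The speed of each coordinate; all arguments of theta then move linearly, whatever the indices. *)
pose e b' i : R := ((b' == a) && (i == m))%:R.
have Qq1 r : th (X.2 b l - X.2 (ord_pred b) r - eta) != 0.
  have -> : X.2 b l - X.2 (ord_pred b) r - eta
    = - (X.2 (ord_pred b) r - X.2 b l + eta) by ring.
  by rewrite (thetaN tau_gt0) oppr_eq0.
pose q t b' i := setc X.2 a m (X.2 a m + t%:C) b' i.
have qE t b' i : q t b' i = X.2 b' i + (e b' i * t)%:C by apply: setc_shift.
have q0 : q 0 = X.2.
  by apply/funext => b'; apply/funext => i; rewrite qE mulr0 addr0.
have H1 : logd (fun t => phi tau z (q t (ord_pred b) k - q t b l + eta))
  ((e (ord_pred b) k - e b l)%:C * (E1 tau (z + (X.2 (ord_pred b) k - X.2 b l + eta))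
      - E1 tau (X.2 (ord_pred b) k - X.2 b l + eta))).
  apply: logd_phi => // t; rewrite !qE !realCM realCD realCN; ring.
have H2 : logd (fun t => \prod_(r < N) th (q t b l - q t (ord_pred b) r - eta))
   (\sum_(r < N) (e b l - e (ord_pred b) r)%:C
       * E1 tau (X.2 b l - X.2 (ord_pred b) r - eta)).
  apply: logd_prod => r _; apply: logd_theta => // t.
  by rewrite !qE !realCM realCD realCN; ring.
have H3 : logd (fun t => \prod_(r < N | r != l) th (q t b l - q t b r))
   (\sum_(r < N | r != l) (e b l - e b r)%:C * E1 tau (X.2 b l - X.2 b r)).
  apply: logd_prod => r rl; apply: logd_theta => // [|t].
    by apply: qq0; rewrite eq_sym.
  by rewrite !qE !realCM realCD realCN; ring.
have den0 : th (- eta) * \prod_(r < N | r != l) th (q 0 b l - q 0 b r) != 0.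
  rewrite q0; apply: (mulf_neq0 eta0); apply/prodf_neq0 => r rl.
  by apply: qq0; rewrite eq_sym.
have H4 := logdM (logdM (logdM H1 H2) (logdV den0 (logdM (logd_cst (th (- eta))) H3)))
  (logd_cst (cexp (X.1 b l / c))).
apply: cdiff_cderiv.
have [f0 fL] : (forall t, L (X.1, setc X.2 a m (X.2 a m + t%:C)) b z k l
   = phi tau z (q t (ord_pred b) k - q t b l + eta)
     * (\prod_(r < N) th (q t b l - q t (ord_pred b) r - eta))
     / (th (- eta) * \prod_(r < N | r != l) th (q t b l - q t b r))
     * cexp (X.1 b l / c)) /\
   L X b z k l = phi tau z (q 0 (ord_pred b) k - q 0 b l + eta)
     * (\prod_(r < N) th (q 0 b l - q 0 (ord_pred b) r - eta))
     / (th (- eta) * \prod_(r < N | r != l) th (q 0 b l - q 0 b r))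
     * cexp (X.1 b l / c).
  by split=> [t|]; rewrite ?q0 mxE.
apply: eq_cdiff (fun t => esym (f0 t)) _; rewrite fL.
move: H4; rewrite /logd; set l1 := _ + 0 : C; set l2 := (Y in _ -> cdiff _ (_ * Y)).
suff -> : l1 = l2 by [].
rewrite /l1 /l2 {l1 l2 H1 H2 H3 f0 fL den0} /own_logder /prev_logder.
have eC b' i : (e b' i)%:C = (b' == a)%:R * (i == m)%:R :> C.
  by rewrite realC_nat -mulnb natrM.
have eB b1 i b2 j : (e b1 i - e b2 j)%:C
    = (b1 == a)%:R * (i == m)%:R - (b2 == a)%:R * (j == m)%:R :> C.
  by rewrite realCD realCN !eC.
have -> : X.2 (ord_pred b) m - X.2 b l + eta
    = - (X.2 b l - X.2 (ord_pred b) m - eta) by ring.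
rewrite (E1N tau_gt0) eB.
move: (E1 tau (z + _) - E1 tau _) => U.
pose F r := E1 tau (X.2 b l - X.2 (ord_pred b) r - eta); rewrite -/(F m).
pose G r := E1 tau (X.2 b l - X.2 b r).
have -> : \sum_(r < N) (e b l - e (ord_pred b) r)%:C
     * E1 tau (X.2 b l - X.2 (ord_pred b) r - eta)
   = (b == a)%:R * (l == m)%:R * (\sum_(r < N) F r) - (ord_pred b == a)%:R * F m.
  rewrite -(@sum_delta_l R N m F) !mulr_sumr -sumrB; apply: eq_bigr => r _.
  by rewrite -/(F r) eB; move: (F r) => Fr; ring.
have -> : \sum_(r < N | r != l) (e b l - e b r)%:C * E1 tau (X.2 b l - X.2 b r)
  = (b == a)%:R * \sum_(r < N | r != l) ((l == m)%:R - (r == m)%:R) * G r.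
  rewrite mulr_sumr; apply: eq_bigr => r _.
  by rewrite -/(G r) eB; move: (G r) => Gr; ring.
rewrite -/(\sum_(r < N) F r) -[\sum_(r < N | _) _ * E1 _ _]/(\sum_(r < N | r != l) ((l == m)%:R - (r == m)%:R) * G r).
move: (\sum_(r < N) F r) (F m) (\sum_(r < N | _) _) => S1 S2 S3.
by ring.
Qed.

(** L^a_ij involves the single momentum p^a_j and L^b_kl only p^b_l, so each half of the bracket
    collapses to one q-derivative; [c] cancels the 1/c of the exponentials. *)
Lemma pbracket_Lmat X a b z w i j k l :
  (forall a' m, dq a' m (fun Y => L Y a z i j) X
    = L X a z i j * ((a == a')%:R * own_logder X a z i j m
                   + (ord_pred a == a')%:R * prev_logder X a z i j m)) ->
  (forall a' m, dq a' m (fun Y => L Y b w k l) X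
    = L X b w k l * ((b == a')%:R * own_logder X b w k l m
                   + (ord_pred b == a')%:R * prev_logder X b w k l m)) ->
  c * pbracket (fun Y => L Y a z i j) (fun Y => L Y b w k l) X
  = L X a z i j * L X b w k l
    * ((b == a)%:R * own_logder X b w k l j + (ord_pred b == a)%:R * prev_logder X b w k l j
       - (a == b)%:R * own_logder X a z i j l - (ord_pred a == b)%:R * prev_logder X a z i j l).
Proof.
move=> HA HB; rewrite /pbracket.
have E1 : \sum_(a' < n) \sum_(m < N) (dp a' m (fun Y => L Y a z i j) X * dq a' m (fun Y => L Y b w k l) X)
   = L X a z i j / c * dq a j (fun Y => L Y b w k l) X.
  transitivity (\sum_(a' < n) (a' == a)%:R * \sum_(m < N) (m == j)%:R
      * (L X a z i j / c * dq a' m (fun Y => L Y b w k l) X)).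
    apply: eq_bigr => a' _; rewrite mulr_sumr; apply: eq_bigr => m _.
    rewrite dp_Lmat -mulnb natrM (eq_sym a) (eq_sym j).
    by move: (dq _ _ _ _) (L X a z i j) => T1 T2; ring.
  by rewrite sum_delta_l sum_delta_l.
have E2 : \sum_(a' < n) \sum_(m < N) (dq a' m (fun Y => L Y a z i j) X * dp a' m (fun Y => L Y b w k l) X)
   = L X b w k l / c * dq b l (fun Y => L Y a z i j) X.
  transitivity (\sum_(a' < n) (a' == b)%:R * \sum_(m < N) (m == l)%:R
      * (L X b w k l / c * dq a' m (fun Y => L Y a z i j) X)).
    apply: eq_bigr => a' _; rewrite mulr_sumr; apply: eq_bigr => m _.
    rewrite dp_Lmat -mulnb natrM (eq_sym b) (eq_sym l).
    by move: (dq _ _ _ _) (L X b w k l) => T1 T2; ring.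
  by rewrite sum_delta_l sum_delta_l.
have -> : \sum_(a' < n) \sum_(m < N) (dp a' m (fun Y => L Y a z i j) X * dq a' m (fun Y => L Y b w k l) X
     - dq a' m (fun Y => L Y a z i j) X * dp a' m (fun Y => L Y b w k l) X)
   = L X a z i j / c * dq a j (fun Y => L Y b w k l) X
     - L X b w k l / c * dq b l (fun Y => L Y a z i j) X.
  by rewrite -E1 -E2 -sumrB; apply: eq_bigr => a' _; rewrite -sumrB.
rewrite HA HB; move: (L X a z i j) (L X b w k l) (own_logder _ _ _ _ _ _)
  (own_logder X a _ _ _ _) (prev_logder _ _ _ _ _ _) (prev_logder X a _ _ _ _).
by move=> A B o1 o2 p1 p2; field.
Qed.


End LaxBrackets.

(** * The functional identity behind the term with a = b *)

Section SameSiteIdentity.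
Variable R : realType.
Local Notation C := R[i].
Variables (N n : nat) (tau eta c : C).
Hypothesis tau_gt0 : 0 < complex.Im tau.
Local Notation th := (theta tau).
Local Notation L := (Lmat tau eta c).
Local Notation own := (own_logder tau eta).
Variables (X : phase R N n) (z w : C) (b : 'I_n).
Implicit Types (i j k l m : 'I_N).
Let x i j := X.2 (ord_pred b) i - X.2 b j + eta.

(** For j different from l, only the denominator factor theta(q_l - q_j) depends on the own-site
    coordinate q_j. *)
Lemma own_logder_neq y k l j : l != j ->
  own X b y k l j = E1 tau (X.2 b l - X.2 b j).
Proof.
move=> lj; rewrite /own_logder (negbTE lj) oppr0 !mul0r !add0r.
rewrite -sumrN (bigD1 j) /=; last by rewrite eq_sym.
rewrite eqxx sub0r mulN1r opprK big1 ?addr0 // => r /andP[_ /negbTE ->].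
by rewrite subr0 mul0r oppr0.
Qed.

(** The product parts depend on the column alone and cancel; only the [phi] parts differ. *)
Lemma own_logder_eq k i j :
  own X b w k j j - own X b z i j j
  = (E1 tau (z + x i j) - E1 tau (x i j)) - (E1 tau (w + x k j) - E1 tau (x k j)).
Proof.
rewrite /own_logder eqxx mulr1n -/(x k j) -/(x i j).
move: (E1 tau (w + x k j)) (E1 tau (x k j)) (E1 tau (z + x i j)) (E1 tau (x i j)).
move=> a1 a2 a3 a4.
set S := \sum_(r < N) _; set T := \sum_(r < N | _) _; move: S T => S T.
by ring.
Qed.

(** Apart from [phi], an entry depends on its column only. Swapping rows or columns between two
    entries thus preserves the product P j * P l, and the identity reduces to one for [phi]. *)
Lemma Lmat_factor : exists P : 'I_N -> C, forall y i j,
  L X b y i j = phi tau y (x i j) * P j.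
Proof.
exists (fun j => (\prod_(l < N) theta tau (X.2 b j - X.2 (ord_pred b) l - eta))
     / (theta tau (- eta) * \prod_(l < N | l != j) theta tau (X.2 b j - X.2 b l))
     * cexp (X.1 b j / c)) => y i j.
by rewrite mxE !mulrA.
Qed.

Hypotheses (z0 : th z != 0) (w0 : th w != 0) (zw0 : th (z - w) != 0).
Hypothesis qq0 : forall i j, i != j -> th (X.2 b i - X.2 b j) != 0.
Hypothesis QQ0 : forall i j, i != j ->
  th (X.2 (ord_pred b) i - X.2 (ord_pred b) j) != 0.
Hypothesis x0 : forall i j, th (x i j) != 0.
Hypothesis zx0 : forall i j, th (z + x i j) != 0.
Hypothesis wx0 : forall i j, th (w + x i j) != 0.

(** The four terms on the right are the entries of L L r, r L L, L s^+ L and L s^- L, in this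
    order. *)
Lemma own_logder_sub (A B : 'I_N -> 'I_N -> C) (P : 'I_N -> C) i j k l :
  (forall i j, A i j = phi tau z (x i j) * P j) ->
  (forall i j, B i j = phi tau w (x i j) * P j) ->
  A i j * B k l * (own X b w k l j - own X b z i j l)
  = (if j == l then E1 tau (z - w) * (A i j * B k l) else
       phi tau (z - w) (X.2 b l - X.2 b j) * (A i l * B k j)
       - E1 tau (X.2 b j - X.2 b l) * (A i j * B k l))
  - (if i == k then E1 tau (z - w) * (A i j * B k l) else
       phi tau (z - w) (X.2 (ord_pred b) i - X.2 (ord_pred b) k)
         * (A k j * B i l)
       - E1 tau (X.2 (ord_pred b) i - X.2 (ord_pred b) k) * (A i j * B k l))
  + A i j * B k l
    * ((i == k)%:R * (E1 tau (z + x i j) - E1 tau (x i j)) + E1 tau (x k j))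
  - A i j * B k l
    * ((i == k)%:R * (E1 tau (w + x k l) - E1 tau (x k l)) + E1 tau (x i l)).
Proof.
move=> HA HB; rewrite !{}HA !{}HB.
have [jl|jl] := eqVneq j l; have [ik|ik] := eqVneq i k.
- rewrite -jl -ik own_logder_eq ?mulr1n ?mulr0n.
  move: (phi _ _ _) (phi tau w _) (P j) (E1 tau (z - w)) (E1 tau (z + _))
    (E1 tau (w + _)) (E1 tau (x i j)) => f1 f2 p e1 e2 e3 e4.
  by ring.
- rewrite -jl own_logder_eq ?mulr1n ?mulr0n.
  have xB : x i j - x k j = X.2 (ord_pred b) i - X.2 (ord_pred b) k by rewrite /x; ring.
  have xB0 : th (x i j - x k j) != 0 by rewrite xB; apply: QQ0.
  have := phi_product tau_gt0 z0 w0 (x0 i j) (x0 k j) zw0 xB0 (zx0 i j) (wx0 k j).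
  rewrite xB.
  move: (phi tau (z - w) _) (phi tau z (x k j)) (phi tau w (x i j)) (phi tau z (x i j))
    (phi tau w (x k j)) (P j) (E1 tau (z - w)) (E1 tau (_ - _)) (E1 tau (z + _))
    (E1 tau (w + _)) (E1 tau (x i j)) (E1 tau (x k j)).
  move=> f1 f2 f3 f4 f5 p e1 e2 e3 e4 e5 e6 H.
  have -> : f1 * (f2 * p * (f3 * p)) = f1 * f2 * f3 * (p * p) by ring.
  by rewrite H; ring.
- rewrite -ik !own_logder_neq ?mulr1n ?mulr0n //; last by rewrite eq_sym.
  have xB : x i j - x i l = X.2 b l - X.2 b j by rewrite /x; ring.
  have xB0 : th (x i j - x i l) != 0 by rewrite xB; apply: qq0; rewrite eq_sym.
  have := phi_product tau_gt0 z0 w0 (x0 i j) (x0 i l) zw0 xB0 (zx0 i j) (wx0 i l).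
  have qN : X.2 b l - X.2 b j = - (X.2 b j - X.2 b l) by ring.
  rewrite xB.
  have -> : E1 tau (X.2 b l - X.2 b j) = - E1 tau (X.2 b j - X.2 b l).
    by rewrite qN (E1N tau_gt0).
  move: (phi tau (z - w) _) (phi tau z (x i l)) (phi tau w (x i j)) (phi tau z (x i j))
    (phi tau w (x i l)) (P j) (P l) (E1 tau (z - w)) (E1 tau (_ - _)) (E1 tau (z + _))
    (E1 tau (w + _)) (E1 tau (x i j)) (E1 tau (x i l)).
  move=> f1 f2 f3 f4 f5 p p' e1 e2 e3 e4 e5 e6 H.
  have -> : f1 * (f2 * p' * (f3 * p)) = f1 * f2 * f3 * (p * p') by ring.
  by rewrite H; ring.
rewrite !own_logder_neq ?mulr1n ?mulr0n //; last by rewrite eq_sym.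
(* Here x i l + al and x k j + be both equal x i j, and x k j - al equals x k l: the exchange
   relation turns the swapped products back into A i j * B k l. *)
pose al := X.2 b l - X.2 b j.
pose be := X.2 (ord_pred b) i - X.2 (ord_pred b) k.
have abcd : x i l + al = x k j + be by rewrite /x /al /be; ring.
have E1' : x k j + be = x i j by rewrite /x /be; ring.
have E2' : x k j - al = x k l by rewrite /x /al; ring.
have al0 : th al != 0 by apply: qq0; rewrite eq_sym.
have be0 : th be != 0 by apply: QQ0.
have ne1 : th (x k j + be) != 0 by rewrite E1'; apply: x0.
have ne2 : th (x k j - al) != 0 by rewrite E2'; apply: x0.
have := phi_exchange tau_gt0 abcd z0 w0 (x0 k j) (x0 i l) zw0 al0 be0 ne1 ne2.
have qN : X.2 b j - X.2 b l = - al by rewrite /al; ring.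
rewrite qN E1' E2' (E1N tau_gt0) -/al -/be.
move: (phi tau (z - w) al) (phi tau (z - w) be) (phi tau z (x i l)) (phi tau w (x k j))
  (phi tau z (x k j)) (phi tau w (x i l)) (phi tau z (x i j)) (phi tau w (x k l))
  (P j) (P l) (E1 tau al) (E1 tau be) (E1 tau (x i l)) (E1 tau (x k j)).
move=> f1 f2 f3 f4 f5 f6 f7 f8 p p' e1 e2 e3 e4 H.
have H' : f1 * (f3 * p' * (f4 * p)) - f2 * (f5 * p * (f6 * p'))
   = f7 * f8 * (e3 + e1 - e4 - e2) * (p * p') by rewrite -H; ring.
have -> : f1 * (f3 * p' * (f4 * p)) = f7 * f8 * (e3 + e1 - e4 - e2) * (p * p')
  + f2 * (f5 * p * (f6 * p')) by rewrite -H' subrK.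
by ring.
Qed.

End SameSiteIdentity.

(** * Coefficients of the tensor matrices *)

Section TensorEntries.
Variables (R : realType) (N : nat).
Local Notation C := R[i].
Implicit Types (A B : 'M[C]_N) (M : 'M[C]_(N * N)) (i j k l p q : 'I_N).

(* the coefficient of E_ij (x) E_kl *)
Definition ent M i j k l : C := M (mxvec_index i k) (mxvec_index j l).

Lemma entP M M' : (forall i j k l, ent M i j k l = ent M' i j k l) -> M = M'.
Proof.
move=> H; apply/matrixP => p q.
by case/mxvec_indexP: p => i k; case/mxvec_indexP: q => j l; apply: H.
Qed.

Lemma entD M M' i j k l : ent (M + M') i j k l = ent M i j k l + ent M' i j k l.
Proof. by rewrite /ent mxE. Qed.

Lemma entN M i j k l : ent (- M) i j k l = - ent M i j k l.
Proof. by rewrite /ent mxE. Qed.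

Lemma entZ a M i j k l : ent (a *: M) i j k l = a * ent M i j k l.
Proof. by rewrite /ent mxE. Qed.

Lemma ent_sum (I : Type) (r : seq I) (P : pred I) (F : I -> 'M[C]_(N * N)) i j k l :
  ent (\sum_(x <- r | P x) F x) i j k l = \sum_(x <- r | P x) ent (F x) i j k l.
Proof. by rewrite /ent summxE. Qed.

Lemma mxvec_index_inj i j k l :
  (mxvec_index i k == mxvec_index j l) = (i == j) && (k == l).
Proof.
have [g gK _] := curry_mxvec_bij N N.
have inj : injective (uncurry (@mxvec_index N N)).
  by move=> u v uv; rewrite -(gK u) // uv gK.
by rewrite -xpair_eqE; apply: (inj_eq inj (i, k) (j, l)).
Qed.

Lemma ent_EE i j k l p q s t :
  ent (EE R i j k l : 'M[C]_(N * N)) p q s t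
  = (i == p)%:R * (j == q)%:R * (k == s)%:R * (l == t)%:R.
Proof.
rewrite /ent /EE mxE !mxvec_index_inj -!natrM !mulnb; congr (_%:R).
by rewrite (eq_sym i) (eq_sym j) (eq_sym k) (eq_sym l); do 4!case: (_ == _).
Qed.

Lemma sum_delta_r (K : nat) (j : 'I_K) (F : 'I_K -> C) :
  \sum_(r < K) (j == r)%:R * F r = F j.
Proof. by rewrite -[RHS]sum_delta_l; apply: eq_bigr => r _; rewrite eq_sym. Qed.

Lemma ent_sum4 (f : 'I_N -> 'I_N -> 'I_N -> 'I_N -> C) i j k l :
  ent (\sum_(p < N) \sum_(q < N) \sum_(s < N) \sum_(t < N) f p q s t *: EE R p q s t) i j k l
  = f i j k l.
Proof.
transitivity (\sum_(p < N) (p == i)%:R * \sum_(q < N) (q == j)%:R *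
    \sum_(s < N) (s == k)%:R * \sum_(t < N) (t == l)%:R * f p q s t).
  rewrite ent_sum; apply: eq_bigr => p _; rewrite ent_sum mulr_sumr.
  apply: eq_bigr => q _; rewrite ent_sum !mulr_sumr.
  apply: eq_bigr => s _; rewrite ent_sum !mulr_sumr.
  by apply: eq_bigr => t _; rewrite entZ ent_EE; ring.
by rewrite !sum_delta_l.
Qed.

Lemma ent_tens A B i j k l : ent (tens A B) i j k l = A i j * B k l.
Proof. exact: (ent_sum4 (fun i j k l => A i j * B k l)). Qed.

Lemma ent_mul M M' i j k l :
  ent (M *m M') i j k l = \sum_(p < N) \sum_(q < N) ent M i p k q * ent M' p j q l.
Proof.
rewrite /ent mxE pair_bigA (reindex _ (curry_mxvec_bij N N)) /=.
by apply: eq_bigr => -[p q] _.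
Qed.

Lemma ent_m1_mul A M i j k l :
  ent (m1 A *m M) i j k l = \sum_(p < N) A i p * ent M p j k l.
Proof.
rewrite ent_mul; apply: eq_bigr => p _; rewrite -[RHS](sum_delta_r k (fun q => A i p * ent M p j q l)).
by apply: eq_bigr => q _; rewrite ent_tens mxE; ring.
Qed.

Lemma ent_mul_m1 A M i j k l :
  ent (M *m m1 A) i j k l = \sum_(p < N) ent M i p k l * A p j.
Proof.
rewrite ent_mul; apply: eq_bigr => p _; rewrite -[RHS](sum_delta_l l (fun q => ent M i p k q * A p j)).
by apply: eq_bigr => q _; rewrite ent_tens mxE; ring.
Qed.

Lemma ent_m2_mul B M i j k l :
  ent (m2 B *m M) i j k l = \sum_(q < N) B k q * ent M i j q l.
Proof.
rewrite ent_mul exchange_big; apply: eq_bigr => q _ /=.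
rewrite -[RHS](sum_delta_r i (fun p => B k q * ent M p j q l)).
by apply: eq_bigr => p _; rewrite ent_tens mxE; ring.
Qed.

Lemma ent_mul_m2 B M i j k l :
  ent (M *m m2 B) i j k l = \sum_(q < N) ent M i j k q * B q l.
Proof.
rewrite ent_mul exchange_big; apply: eq_bigr => q _ /=.
rewrite -[RHS](sum_delta_l j (fun p => ent M i p k q * B q l)).
by apply: eq_bigr => p _; rewrite ent_tens mxE; ring.
Qed.

Lemma m1m2C A B : m1 A *m m2 B = m2 B *m m1 A.
Proof.
apply: entP => i j k l; rewrite ent_m1_mul ent_m2_mul.
transitivity (A i j * B k l).
  rewrite -[RHS](sum_delta_l j (fun p => A i p * B k l)).
  by apply: eq_bigr => p _; rewrite ent_tens mxE; ring.
rewrite -[LHS](sum_delta_l l (fun q => A i j * B k q)).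
by apply: eq_bigr => p _; rewrite ent_tens mxE; ring.
Qed.

Lemma ent_m1m2 A B i j k l : ent (m1 A *m m2 B) i j k l = A i j * B k l.
Proof.
rewrite ent_m1_mul -[RHS](sum_delta_l j (fun p => A i p * B k l)).
by apply: eq_bigr => p _; rewrite ent_tens mxE; ring.
Qed.

Variables (n : nat) (tau eta c : C) (X : phase R N n).
Local Notation L := (Lmat tau eta c X).
Local Notation prev := (prev_logder tau eta X).

Lemma ent_rmat a z w i j k l : ent (rmat tau X a z w) i j k l
  = (i == l)%:R * (k == j)%:R * ((i != j)%:R * phi tau (z - w) (X.2 a i - X.2 a j))
  + (i == j)%:R * (k == l)%:R * ((i == k)%:R * E1 tau (z - w)
                                 - (i != k)%:R * E1 tau (X.2 a i - X.2 a k)).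
Proof.
rewrite /rmat !entD entN entZ.
have mk (b : bool) (v : C) : (if b then v else 0) = b%:R * v.
  by case: b; rewrite ?mul1r ?mul0r.
have -> : ent (\sum_(p < N) \sum_(q < N | p != q)
      phi tau (z - w) (X.2 a p - X.2 a q) *: EE R p q q p) i j k l
  = (i == l)%:R * (k == j)%:R * ((i != j)%:R * phi tau (z - w) (X.2 a i - X.2 a j)).
  transitivity (\sum_(p < N) (p == i)%:R * \sum_(q < N) (q == j)%:R *
      ((p == l)%:R * (k == q)%:R * ((p != q)%:R * phi tau (z - w) (X.2 a p - X.2 a q)))).
    rewrite ent_sum; apply: eq_bigr => p _; rewrite ent_sum mulr_sumr big_mkcond.
    apply: eq_bigr => q _; rewrite mk entZ ent_EE (eq_sym k).
    by move: (phi _ _ _) => f; ring.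
  by rewrite !sum_delta_l.
have -> : ent (\sum_(p < N) EE R p p p p : 'M[C]_(N * N)) i j k l
   = (i == j)%:R * (k == l)%:R * (i == k)%:R.
  transitivity (\sum_(p < N) (p == i)%:R * ((p == j)%:R * (p == k)%:R * (p == l)%:R) : C).
    by rewrite ent_sum; apply: eq_bigr => p _; rewrite ent_EE; ring.
  rewrite sum_delta_l -!natrM !mulnb; congr (_%:R).
  by case: eqVneq => //= _; case: eqVneq => //= [->|_]; rewrite ?andbT ?andbF.
have -> : ent (\sum_(p < N) \sum_(q < N | p != q)
      E1 tau (X.2 a p - X.2 a q) *: EE R p p q q) i j k l
  = (i == j)%:R * (k == l)%:R * ((i != k)%:R * E1 tau (X.2 a i - X.2 a k)).
  transitivity (\sum_(p < N) (p == i)%:R * \sum_(q < N) (q == k)%:R *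
      ((p == j)%:R * (q == l)%:R * ((p != q)%:R * E1 tau (X.2 a p - X.2 a q)))).
    rewrite ent_sum; apply: eq_bigr => p _; rewrite ent_sum mulr_sumr big_mkcond.
    apply: eq_bigr => q _; rewrite mk entZ ent_EE.
    by move: (E1 _ _) => f; ring.
  by rewrite !sum_delta_l.
by move: (phi _ _ _) (E1 tau (z - w)) (E1 tau _) => f e1 e2; ring.
Qed.

Lemma ent_s12 a z i j k l : ent (s12 tau eta c X a z) i j k l
  = (k == l)%:R * (invmx (L a z) i k * Dent tau eta c X a z k j).
Proof.
transitivity (\sum_(p < N) (p == k)%:R * \sum_(q < N) (q == j)%:R *
    \sum_(m < N) (m == i)%:R * ((p == l)%:R * (invmx (L a z) m p * Dent tau eta c X a z p q))).
  rewrite ent_sum; apply: eq_bigr => p _; rewrite ent_sum mulr_sumr.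
  apply: eq_bigr => q _; rewrite ent_sum !mulr_sumr.
  apply: eq_bigr => m _; rewrite entZ ent_EE.
  by move: (invmx _ _ _) (Dent _ _ _ _ _ _ _ _) => f g; ring.
by rewrite !sum_delta_l.
Qed.

Lemma ent_s21 a z i j k l : ent (s21 tau eta c X a z) i j k l
  = (i == j)%:R * (invmx (L a z) k i * Dent tau eta c X a z i l).
Proof.
transitivity (\sum_(p < N) (p == i)%:R * \sum_(q < N) (q == l)%:R *
    \sum_(m < N) (m == k)%:R * ((p == j)%:R * (invmx (L a z) m p * Dent tau eta c X a z p q))).
  rewrite ent_sum; apply: eq_bigr => p _; rewrite ent_sum mulr_sumr.
  apply: eq_bigr => q _; rewrite ent_sum !mulr_sumr.
  apply: eq_bigr => m _; rewrite entZ ent_EE.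
  by move: (invmx _ _ _) (Dent _ _ _ _ _ _ _ _) => f g; ring.
by rewrite !sum_delta_l.
Qed.

Lemma ent_uplus a i j k l : ent (uplus tau eta X a) i j k l
  = (i == j)%:R * (k == l)%:R * E1 tau (X.2 (ord_pred a) k - X.2 a i + eta).
Proof.
transitivity (\sum_(p < N) (p == i)%:R * \sum_(q < N) (q == k)%:R *
    ((p == j)%:R * (q == l)%:R * E1 tau (X.2 (ord_pred a) q - X.2 a p + eta))).
  rewrite ent_sum; apply: eq_bigr => p _; rewrite ent_sum mulr_sumr.
  apply: eq_bigr => q _; rewrite entZ ent_EE.
  by move: (E1 _ _) => f; ring.
by rewrite !sum_delta_l.
Qed.

Lemma ent_uminus a i j k l : ent (uminus tau eta X a) i j k l
  = - ((i == j)%:R * (k == l)%:R * E1 tau (X.2 (ord_pred a) i - X.2 a k + eta)).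
Proof.
rewrite /uminus entN; congr (- _).
transitivity (\sum_(p < N) (p == i)%:R * \sum_(q < N) (q == k)%:R *
    ((p == j)%:R * (q == l)%:R * E1 tau (X.2 (ord_pred a) p - X.2 a q + eta))).
  rewrite ent_sum; apply: eq_bigr => p _; rewrite ent_sum mulr_sumr.
  apply: eq_bigr => q _; rewrite entZ ent_EE.
  by move: (E1 _ _) => f; ring.
by rewrite !sum_delta_l.
Qed.

Lemma mulmx_invmx_entry A i k : A \in unitmx ->
  \sum_(p < N) A i p * invmx A p k = (i == k)%:R.
Proof. by move=> uA; have /matrixP/(_ i k) := mulmxV uA; rewrite !mxE. Qed.

Lemma DentE a z i j : Dent tau eta c X a z i j
  = L a z i j * (E1 tau (z + (X.2 (ord_pred a) i - X.2 a j + eta))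
                 - E1 tau (X.2 (ord_pred a) i - X.2 a j + eta)).
Proof. by rewrite /Dent !addrA. Qed.

Lemma ent_m1_splus a z i j k l : L a z \in unitmx ->
  ent (m1 (L a z) *m splus tau eta c X a z) i j k l
  = (k == l)%:R * (L a z i j * prev a z i j k).
Proof.
move=> uA; rewrite ent_m1_mul.
transitivity ((k == l)%:R * ((i == k)%:R * Dent tau eta c X a z k j)
  + (k == l)%:R * (L a z i j * E1 tau (X.2 (ord_pred a) k - X.2 a j + eta))).
  rewrite -(mulmx_invmx_entry i k uA).
  rewrite -(sum_delta_l j (fun p => L a z i p * E1 tau (X.2 (ord_pred a) k - X.2 a p + eta))).
  rewrite mulr_suml !mulr_sumr -big_split; apply: eq_bigr => p _ /=.
  rewrite entD ent_s12 ent_uplus.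
  by move: (L a z i p) (invmx _ _ _) (Dent _ _ _ _ _ _ _ _) (E1 _ _) => f1 f2 f3 f4; ring.
rewrite DentE /prev_logder; case: (eqVneq i k) => [<-|_]; rewrite ?mulr1n ?mulr0n.
  by move: (L a z i j) (E1 _ _) (E1 tau (z + _)) => f1 f2 f3; ring.
by rewrite !mul0r mulr0 !add0r.
Qed.

Lemma ent_m2_sminus a z i j k l : L a z \in unitmx ->
  ent (m2 (L a z) *m sminus tau eta c X a z) i j k l
  = (i == j)%:R * (L a z k l * prev a z k l i).
Proof.
move=> uA; rewrite ent_m2_mul.
transitivity ((i == j)%:R * ((k == i)%:R * Dent tau eta c X a z i l)
  + (i == j)%:R * (L a z k l * E1 tau (X.2 (ord_pred a) i - X.2 a l + eta))).
  rewrite -(mulmx_invmx_entry k i uA).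
  rewrite -(sum_delta_l l (fun p => L a z k p * E1 tau (X.2 (ord_pred a) i - X.2 a p + eta))).
  rewrite mulr_suml !mulr_sumr -big_split; apply: eq_bigr => p _ /=.
  rewrite entD entN ent_s21 ent_uminus.
  by move: (L a z k p) (invmx _ _ _) (Dent _ _ _ _ _ _ _ _) (E1 _ _) => f1 f2 f3 f4; ring.
rewrite DentE /prev_logder; case: (eqVneq k i) => [<-|_]; rewrite ?mulr1n ?mulr0n.
  by move: (L a z k l) (E1 _ _) (E1 tau (z + _)) => f1 f2 f3; ring.
by rewrite !mul0r mulr0 !add0r.
Qed.

End TensorEntries.

Section RMatrixProducts.
Variables (R : realType) (N n : nat) (tau : R[i]) (X : phase R N n).
Implicit Types (A B : 'M[R[i]]_N) (i j k l : 'I_N).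

Lemma ent_m1m2_rmat A B a z w i j k l :
  ent (m1 A *m m2 B *m rmat tau X a z w) i j k l
  = if j == l then E1 tau (z - w) * (A i j * B k l) else
       phi tau (z - w) (X.2 a l - X.2 a j) * (A i l * B k j)
       - E1 tau (X.2 a j - X.2 a l) * (A i j * B k l).
Proof.
rewrite ent_mul.
transitivity (
  \sum_(p < N) (p == l)%:R * \sum_(q < N) (q == j)%:R * (A i p * B k q
      * ((p != j)%:R * phi tau (z - w) (X.2 a p - X.2 a j)))
  + \sum_(p < N) (p == j)%:R * \sum_(q < N) (q == l)%:R * (A i p * B k q
      * ((p == q)%:R * E1 tau (z - w) - (p != q)%:R * E1 tau (X.2 a p - X.2 a q)))).
  rewrite -big_split; apply: eq_bigr => p _ /=; rewrite !mulr_sumr -big_split.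
  apply: eq_bigr => q _ /=; rewrite ent_m1m2 ent_rmat.
  by move: (phi _ _ _) (E1 tau _) (E1 tau (X.2 a p - _)) => f e1 e2; ring.
rewrite !sum_delta_l (eq_sym l j); case: (eqVneq j l) => [<-|_] /=.
  by rewrite mulr1n mulr0n !mul0r mulr0 add0r subr0 mul1r mulrC.
rewrite mulr1n mulr0n.
by move: (phi _ _ _) (E1 tau _) (E1 tau (X.2 a j - _)) => f e1 e2; ring.
Qed.

Lemma ent_rmat_m1m2 A B a z w i j k l :
  ent (rmat tau X a z w *m m1 A *m m2 B) i j k l
  = if i == k then E1 tau (z - w) * (A i j * B k l) else
       phi tau (z - w) (X.2 a i - X.2 a k) * (A k j * B i l)
       - E1 tau (X.2 a i - X.2 a k) * (A i j * B k l).
Proof.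
rewrite -mulmxA ent_mul.
transitivity (
  \sum_(p < N) (k == p)%:R * \sum_(q < N) (i == q)%:R * (A p j * B q l
      * ((i != p)%:R * phi tau (z - w) (X.2 a i - X.2 a p)))
  + \sum_(p < N) (i == p)%:R * \sum_(q < N) (k == q)%:R * (A p j * B q l
      * ((i == k)%:R * E1 tau (z - w) - (i != k)%:R * E1 tau (X.2 a i - X.2 a k)))).
  rewrite -big_split; apply: eq_bigr => p _ /=; rewrite !mulr_sumr -big_split.
  apply: eq_bigr => q _ /=; rewrite ent_m1m2 ent_rmat.
  by move: (phi _ _ _) (E1 tau _) (E1 tau (X.2 a i - _)) => f e1 e2; ring.
rewrite !sum_delta_r; case: (eqVneq i k) => [<-|_] /=.
  by rewrite mulr1n mulr0n !mul0r mulr0 add0r subr0 mul1r mulrC.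
rewrite mulr1n mulr0n.
by move: (phi _ _ _) (E1 tau _) (E1 tau (X.2 a i - _)) => f e1 e2; ring.
Qed.

End RMatrixProducts.

Lemma mulr_deltaC (V : pzRingType) (T : eqType) (a b : T) (F : T -> V) :
  (a == b)%:R * F b = (a == b)%:R * F a.
Proof. by case: eqVneq => [->|_]; rewrite ?mul0r. Qed.

Theorem theorem1 (R : realType) (N n : nat) (tau eta c : R[i]) :
  (0 < N)%N -> (0 < n)%N -> 0 < complex.Im tau -> c != 0 ->
  forall (X : phase R N n) (z w : R[i]) (a b : 'I_n),
  generic tau eta c X z w ->
  c *: pbracket12 (fun Y => Lmat tau eta c Y a z) (fun Y => Lmat tau eta c Y b w) X =
    (a == b)%:R *:
      (m1 (Lmat tau eta c X b z) *m m2 (Lmat tau eta c X b w) *m rmat tau X b z w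
       - rmat tau X (ord_pred b) z w *m m1 (Lmat tau eta c X b z) *m m2 (Lmat tau eta c X b w)
       + m1 (Lmat tau eta c X b z) *m splus tau eta c X b z *m m2 (Lmat tau eta c X b w)
       - m2 (Lmat tau eta c X b w) *m sminus tau eta c X b w *m m1 (Lmat tau eta c X b z))
    + (a == ord_pred b)%:R *:
      (m1 (Lmat tau eta c X (ord_pred b) z) *m m2 (Lmat tau eta c X b w)
         *m sminus tau eta c X b w)
    - (a == ordS b)%:R *:
      (m1 (Lmat tau eta c X (ordS b) z) *m m2 (Lmat tau eta c X b w)
         *m splus tau eta c X (ordS b) z).
Proof.
move=> _ _ tau0 c0 X z w a b [[eta0 z0 w0 zw0] [qq0 [Qq0 uL]]].
pose x s i j := X.2 (ord_pred s) i - X.2 s j + eta.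
have x0 s i j : theta tau (x s i j) != 0 by case: (Qq0 s i j).
have zx0 s i j : theta tau (z + x s i j) != 0.
  by case: (Qq0 s i j) => _ h _; rewrite /x !addrA.
have wx0 s i j : theta tau (w + x s i j) != 0.
  by case: (Qq0 s i j) => _ _ h; rewrite /x !addrA.
have uz s : Lmat tau eta c X s z \in unitmx by case: (uL s).
have uw s : Lmat tau eta c X s w \in unitmx by case: (uL s).
apply: entP => i j k l.
have HA a' m := dq_Lmat c tau0 a' m eta0 z0 (qq0 a) (x0 a) (zx0 a i j).
have HB a' m := dq_Lmat c tau0 a' m eta0 w0 (qq0 b) (x0 b) (wx0 b k l).
rewrite entZ ent_sum4 (pbracket_Lmat c0 HA HB).
rewrite entD entN entZ entD !entZ.
have -> : ent (m1 (Lmat tau eta c X (ord_pred b) z) *m m2 (Lmat tau eta c X b w)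
         *m sminus tau eta c X b w) i j k l
  = Lmat tau eta c X (ord_pred b) z i j * Lmat tau eta c X b w k l
    * prev_logder tau eta X b w k l j.
  rewrite -mulmxA ent_m1_mul.
  rewrite -[RHS]mulrA -(sum_delta_l j (fun p => Lmat tau eta c X (ord_pred b) z i p
     * (Lmat tau eta c X b w k l * prev_logder tau eta X b w k l p))).
  apply: eq_bigr => p _; rewrite (ent_m2_sminus _ _ _ _ (uw b)).
  by move: (Lmat _ _ _ _ _ _ _ _) (prev_logder _ _ _ _ _ _ _ _) (Lmat _ _ _ _ _ _ i p) => *; ring.
have -> : ent (m1 (Lmat tau eta c X (ordS b) z) *m m2 (Lmat tau eta c X b w)
         *m splus tau eta c X (ordS b) z) i j k l
  = Lmat tau eta c X (ordS b) z i j * Lmat tau eta c X b w k l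
    * prev_logder tau eta X (ordS b) z i j l.
  rewrite m1m2C -mulmxA ent_m2_mul.
  rewrite -mulrA mulrCA -(sum_delta_l l (fun q => Lmat tau eta c X b w k q
     * (Lmat tau eta c X (ordS b) z i j * prev_logder tau eta X (ordS b) z i j q))).
  apply: eq_bigr => q _; rewrite (ent_m1_splus _ _ _ _ (uz _)).
  by move: (Lmat _ _ _ _ _ _ _ _) (prev_logder _ _ _ _ _ _ _ _) (Lmat _ _ _ _ _ _ k q) => *; ring.
set OWN := ent _ i j k l.
have OWNE : OWN = Lmat tau eta c X b z i j * Lmat tau eta c X b w k l
    * (own_logder tau eta X b w k l j - own_logder tau eta X b z i j l).
  have [P PE] := Lmat_factor tau eta c X b.
  rewrite (own_logder_sub tau0 z0 w0 zw0 (qq0 b) (qq0 (ord_pred b)) (x0 b) (zx0 b) (wx0 b)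
    i j k l (PE z) (PE w)).
  rewrite /OWN !(entD, entN) ent_m1m2_rmat ent_rmat_m1m2; congr (_ - _ + _ - _).
    rewrite ent_mul_m2.
    transitivity (Lmat tau eta c X b z i j * Lmat tau eta c X b w k l
      * prev_logder tau eta X b z i j k); last by [].
    rewrite -(sum_delta_r k (fun q => Lmat tau eta c X b z i j * Lmat tau eta c X b w q l
      * prev_logder tau eta X b z i j k)).
    apply: eq_bigr => q _; rewrite (ent_m1_splus _ _ _ _ (uz b)).
    by move: (Lmat tau eta c X b z i j) (prev_logder tau eta X b z i j k)
      (Lmat tau eta c X b w q l) => *; ring.
  rewrite ent_mul_m1.
  transitivity (Lmat tau eta c X b z i j * Lmat tau eta c X b w k l
    * prev_logder tau eta X b w k l i); last by rewrite /prev_logder (eq_sym k i).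
  rewrite -(sum_delta_r i (fun q => Lmat tau eta c X b z q j * Lmat tau eta c X b w k l
    * prev_logder tau eta X b w k l i)).
  apply: eq_bigr => q _; rewrite (ent_m2_sminus _ _ _ _ (uw b)).
  by move: (Lmat tau eta c X b w k l) (prev_logder tau eta X b w k l i)
    (Lmat tau eta c X b z q j) => *; ring.
rewrite {}OWNE {OWN} (eq_sym b a) (eq_sym (ord_pred b) a).
have -> : (ord_pred a == b) = (a == ordS b).
  by apply/eqP/eqP => [<-|->]; rewrite ?ord_predK ?ordSK.
rewrite (mulr_deltaC a b (fun s => Lmat tau eta c X s z i j * Lmat tau eta c X b w k l
  * (own_logder tau eta X b w k l j - own_logder tau eta X s z i j l))).
rewrite (mulr_deltaC a (ord_pred b) (fun s => Lmat tau eta c X s z i j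
  * Lmat tau eta c X b w k l * prev_logder tau eta X b w k l j)).
rewrite (mulr_deltaC a (ordS b) (fun s => Lmat tau eta c X s z i j
  * Lmat tau eta c X b w k l * prev_logder tau eta X s z i j l)).
move: (Lmat tau eta c X a z i j) (Lmat tau eta c X b w k l)
  (own_logder tau eta X b w k l j) (own_logder tau eta X a z i j l)
  (prev_logder tau eta X b w k l j) (prev_logder tau eta X a z i j l) => *.
by ring.
Qed.
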